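(* Let $(M,I,J,K,\Omega)$ be an HKT-manifold with $\dim_{\mathbb H}M=n$ (i.e. $\dim_{\mathbb R}M=4n$), and let $\omega_I$ be the Hermitian form, with respect to $I$, of the associated quaternionic Hermitian metric. Then the following conditions are equivalent. (i) $\bar\partial(\Omega^n)=0$, where $\bar\partial$ is the Dolbeault operator of the complex manifold $(M,I)$. (ii) $\nabla(\Omega^n)=0$, where $\nabla$ is the Obata connection of $(M,I,J,K)$. (iii) The manifold $(M,I)$ with the quaternionic Hermitian metric is balanced as a Hermitian manifold, that is, $d(\omega_I^{2n-1})=0$.
   Context: A hypercomplex manifold $(M,I,J,K)$ is a smooth manifold with three integrable almost complex structures satisfying $I^2=J^2=K^2=IJK=-\mathrm{Id}_{TM}$. A quaternionic Hermitian metric on it is a Riemannian metric $g$ invariant under the action of unit quaternions (equivalently, under $I,J,K$). Put $\omega_I=g(\cdot,I\cdot)$, $\omega_J=g(\cdot,J\cdot)$, $\omega_K=g(\cdot,K\cdot)$ and $\Omega=\omega_J+\sqrt{-1}\,\omega_K$; $\Omega$ is of Hodge type $(2,0)$ with respect to $I$. The metric is HKT, and $(M,I,J,K,\Omega)$ is an HKT-manifold with HKT-form $\Omega$, if $\partial\Omega=0$, where $\partial$ is the $(1,0)$-part of $d$ on $(M,I)$. The form $\Omega$ determines $g$. The Obata connection is the unique torsion-free connection on $TM$ preserving $I,J,K$. A Hermitian manifold of complex dimension $m$ with Hermitian form $\omega$ is balanced if $d(\omega^{m-1})=0$; here $m=2n$. *)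

(* Defs.v *)
From mathcomp Require Import all_boot all_order all_algebra all_fingroup.
From mathcomp Require Import all_classical all_reals all_analysis.
From mathcomp Require Import complex.

Set Implicit Arguments.
Unset Strict Implicit.
Unset Printing Implicit Defensive.

Import Order.TTheory GRing.Theory Num.Theory numFieldNormedType.Exports.
Local Open Scope classical_set_scope.
Local Open Scope ring_scope.
Local Open Scope complex_scope.

(* Tangent vectors are columns: an endomorphism A sends v to A *m v, so that  *)
(* composition of endomorphisms is the matrix product in the usual order.     *)

Section Calculus.
Context {R : realType} {m : nat}.
Implicit Types (U : set 'cV[R]_m) (X Y : 'cV[R]_m -> 'cV[R]_m).

Definition basis_vec (j : 'I_m) : 'cV[R]_m := delta_mx j 0.

Definition partial (j : 'I_m) (f : 'cV[R]_m -> R) : 'cV[R]_m -> R :=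
  fun x => 'D_(basis_vec j) f x.

(* C^infinity on an open set: all iterated partial derivatives exist and are  *)
(* continuous.                                                                *)
Definition smooth_on U (f : 'cV[R]_m -> R) : Prop :=
  forall (s : seq 'I_m) (x : 'cV[R]_m), U x ->
    {for x, continuous (foldr partial f s)} /\
    (forall j : 'I_m, derivable (foldr partial f s) x (basis_vec j)).

Definition smooth_mx_on (p q : nat) U (A : 'cV[R]_m -> 'M[R]_(p, q)) : Prop :=
  forall i j, smooth_on U (fun x => A x i j).

Definition jacobian_mx (f : 'cV[R]_m -> 'cV[R]_m) (x : 'cV[R]_m) : 'M[R]_m :=
  \matrix_(i, j) partial j (fun y => f y i 0) x.

Definition appf (A : 'cV[R]_m -> 'M[R]_m) X : 'cV[R]_m -> 'cV[R]_m :=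
  fun x => A x *m X x.

Definition lie_bracket X Y : 'cV[R]_m -> 'cV[R]_m :=
  fun x => 'D_(X x) Y x - 'D_(Y x) X x.

Definition nijenhuis (A : 'cV[R]_m -> 'M[R]_m) X Y : 'cV[R]_m -> 'cV[R]_m :=
  fun x => lie_bracket (appf A X) (appf A Y) x
           - appf A (lie_bracket (appf A X) Y) x
           - appf A (lie_bracket X (appf A Y)) x
           - lie_bracket X Y x.

Definition cpartial (j : 'I_m) (f : 'cV[R]_m -> R[i]) (x : 'cV[R]_m) : R[i] :=
  (partial j (fun y => complex.Re (f y)) x) +i*
  (partial j (fun y => complex.Im (f y)) x).

End Calculus.

(* [chart_fun] and [chart_inv] are total functions, meaningful only on        *)
(* [chart_dom] and [chart_cod] respectively.                                  *)
Record chart (R : realType) (m : nat) (T : topologicalType) := Chart {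
  chart_dom : set T;
  chart_cod : set 'cV[R]_m;
  chart_fun : T -> 'cV[R]_m;
  chart_inv : 'cV[R]_m -> T;
  chart_dom_open : open chart_dom;
  chart_cod_open : open chart_cod;
  chart_funP : forall p, chart_dom p -> chart_cod (chart_fun p);
  chart_invP : forall x, chart_cod x -> chart_dom (chart_inv x);
  chart_funK : forall p, chart_dom p -> chart_inv (chart_fun p) = p;
  chart_invK : forall x, chart_cod x -> chart_fun (chart_inv x) = x;
  chart_fun_cont : {within chart_dom, continuous chart_fun};
  chart_inv_cont : {within chart_cod, continuous chart_inv}
}.

Definition transition (R : realType) (m : nat) (T : topologicalType)
    (a b : chart R m T) : 'cV[R]_m -> 'cV[R]_m :=
  fun x => chart_fun b (chart_inv a x).

Definition overlap (R : realType) (m : nat) (T : topologicalType)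
    (a b : chart R m T) : set 'cV[R]_m :=
  [set x | chart_cod a x /\ chart_dom b (chart_inv a x)].

Record manifold (R : realType) (m : nat) := Manifold {
  points :> topologicalType;
  chart_index : Type;
  charts : chart_index -> chart R m points;
  manifold_hausdorff : hausdorff_space points;
  manifold_second_countable : @second_countable points;
  charts_cover : forall p : points, exists a, chart_dom (charts a) p;
  charts_smooth : forall a b,
    smooth_mx_on (overlap (charts a) (charts b))
                 (transition (charts a) (charts b))
}.

Section TensorFields.
Context {R : realType} {m : nat} (M : manifold R m).
Implicit Types (a b : chart_index M).

Definition dom a : set 'cV[R]_m := chart_cod (charts a).

Definition trans a b : 'cV[R]_m -> 'cV[R]_m :=
  transition (charts a) (charts b).

Definition trans_jac a b : 'cV[R]_m -> 'M[R]_m := jacobian_mx (trans a b).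

(* Tensor fields and connections are given by their components in all charts, *)
(* which are smooth and obey the transformation law on overlaps.              *)
Definition components := chart_index M -> 'cV[R]_m -> 'M[R]_m.

Definition endo_field (A : components) : Prop :=
  (forall a, smooth_mx_on (dom a) (A a)) /\
  (forall a b x, overlap (charts a) (charts b) x ->
     trans_jac a b x *m A a x = A b (trans a b x) *m trans_jac a b x).

Definition almost_complex (A : components) : Prop :=
  endo_field A /\ (forall a x, dom a x -> A a x *m A a x = - 1%:M).

Definition integrable_acs (A : components) : Prop :=
  almost_complex A /\
  (forall a (X Y : 'cV[R]_m -> 'cV[R]_m),
     smooth_mx_on (dom a) X -> smooth_mx_on (dom a) Y ->
     forall x, dom a x -> nijenhuis (A a) X Y x = 0).

Definition riemannian (g : components) : Prop :=
  [/\ forall a, smooth_mx_on (dom a) (g a),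
      forall a b x, overlap (charts a) (charts b) x ->
        g a x = (trans_jac a b x)^T *m g b (trans a b x) *m trans_jac a b x,
      forall a x, dom a x -> (g a x)^T = g a x &
      forall a x (v : 'cV[R]_m), dom a x -> v != 0 ->
        0 < (v^T *m g a x *m v) 0 0].

Record hypercomplex := Hypercomplex {
  cI : components;
  cJ : components;
  cK : components;
  cI_integrable : integrable_acs cI;
  cJ_integrable : integrable_acs cJ;
  cK_integrable : integrable_acs cK;
  cIJK : forall a x, dom a x -> cI a x *m cJ a x *m cK a x = - 1%:M
}.

Record quaternionic_hermitian (H : hypercomplex) := QuaternionicHermitian {
  metric : components;
  metric_riemannian : riemannian metric;
  metric_invariant : forall (t u v w : R),
    t ^+ 2 + u ^+ 2 + v ^+ 2 + w ^+ 2 = 1 ->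
    forall a x, dom a x ->
      let q := t%:M + u *: cI H a x + v *: cJ H a x + w *: cK H a x in
      q^T *m metric a x *m q = metric a x
}.

(* The matrix [conn a j x] is that of Y |-> nabla_(d/dx_j) Y - (d/dx_j) Y in  *)
(* the coordinate frame of the chart a.                                       *)
Record connection := Connection {
  conn : chart_index M -> 'I_m -> 'cV[R]_m -> 'M[R]_m;
  conn_smooth : forall a j, smooth_mx_on (dom a) (conn a j);
  conn_trans : forall a b j x, overlap (charts a) (charts b) x ->
    trans_jac a b x *m conn a j x =
    'D_(basis_vec j) (trans_jac a b) x +
    (\sum_(p < m) trans_jac a b x p j *: conn b p (trans a b x))
      *m trans_jac a b x
}.

Definition cov_deriv (D : connection) a (X Y : 'cV[R]_m -> 'cV[R]_m) :
    'cV[R]_m -> 'cV[R]_m :=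
  fun x => 'D_(X x) Y x + (\sum_(j < m) X x j 0 *: conn D a j x) *m Y x.

Definition torsion_free (D : connection) : Prop :=
  forall a (X Y : 'cV[R]_m -> 'cV[R]_m),
    smooth_mx_on (dom a) X -> smooth_mx_on (dom a) Y ->
    forall x, dom a x ->
      cov_deriv D a X Y x - cov_deriv D a Y X x = lie_bracket X Y x.

Definition preserves (D : connection) (A : components) : Prop :=
  forall a (X Y : 'cV[R]_m -> 'cV[R]_m),
    smooth_mx_on (dom a) X -> smooth_mx_on (dom a) Y ->
    forall x, dom a x ->
      cov_deriv D a X (appf (A a) Y) x = appf (A a) (cov_deriv D a X Y) x.

Definition is_obata (H : hypercomplex) (D : connection) : Prop :=
  [/\ torsion_free D, preserves D (cI H), preserves D (cJ H) &
      preserves D (cK H)].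

End TensorFields.

Section Forms.
Context {R : realType} {m : nat} (M : manifold R m).
Implicit Types (a : chart_index M) (x : 'cV[R]_m).

Local Notation C := R[i].
Local Notation to_C := (map_mx (real_complex R)).

(* A complex k-form is given in each chart by its value at a point on k       *)
(* complexified tangent vectors, the columns of a matrix. Multilinearity,     *)
(* antisymmetry and smoothness are not part of the type; all the forms used   *)
(* below are derived from hypercomplex structures and metrics.                *)
Definition kform (k : nat) :=
  chart_index M -> 'cV[R]_m -> 'M[C]_(m, k) -> C.

Definition form_eq0 (k : nat) (f : kform k) : Prop :=
  forall a x, dom a x -> forall v, f a x v = 0.

Definition dir_deriv (u : 'cV[C]_m) (f : 'cV[R]_m -> C) x : C :=
  \sum_(j < m) u j 0 * cpartial j f x.

Definition ext_d (k : nat) (f : kform k) : kform k.+1 :=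
  fun a x v => \sum_(i < k.+1)
    (-1) ^+ i * dir_deriv (col i v) (fun y => f a y (col' i v)) x.

Definition wedge (k l : nat) (f : kform k) (h : kform l) : kform (k + l) :=
  fun a x v => ((k`! * l`!)%N%:R)^-1 *
    \sum_(s : 'S_(k + l))
      (-1) ^+ s * (f a x (lsubmx (col_perm s v)) *
                   h a x (rsubmx (col_perm s v))).

Fixpoint wedge_pow (k : nat) (f : kform k) (n : nat) : kform (n * k) :=
  match n return kform (n * k) with
  | 0 => fun _ _ _ => 1
  | n'.+1 => wedge f (@wedge_pow k f n')
  end.

Definition form_add (k : nat) (f h : kform k) : kform k :=
  fun a x v => f a x v + h a x v.

Definition form_scale (k : nat) (c : C) (f : kform k) : kform k :=
  fun a x v => c * f a x v.

Definition cov_deriv_form (D : connection M) (k : nat) (f : kform k)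
    a x (u : 'cV[C]_m) (v : 'M[C]_(m, k)) : C :=
  let G := \sum_(j < m) u j 0 *: to_C (conn D a j x) in
  dir_deriv u (fun y => f a y v) x -
  \sum_(i < k)
    f a x (\matrix_(p, q) (if q == i then (G *m v) p q else v p q)).

Definition parallel (D : connection M) (k : nat) (f : kform k) : Prop :=
  forall a x, dom a x -> forall u v, cov_deriv_form D f a x u v = 0.

(* The projections of the complexified tangent space onto the eigenspaces     *)
(* T^(1,0) and T^(0,1) of A, for the eigenvalues +i and -i.                   *)
Definition proj10 (A : components M) a x : 'M[C]_m :=
  2^-1 *: (1%:M - 'i *: to_C (A a x)).

Definition proj01 (A : components M) a x : 'M[C]_m :=
  2^-1 *: (1%:M + 'i *: to_C (A a x)).

(* Component of type (p, k - p) with respect to A. *)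
Definition type_part (A : components M) (p k : nat) (f : kform k) : kform k :=
  fun a x v => \sum_(S : {set 'I_k} | #|S| == p)
    f a x (\matrix_(i, j) (if j \in S then (proj10 A a x *m v) i j
                                      else (proj01 A a x *m v) i j)).

(* On forms of type (p, q), [del] is the component of type (p + 1, q) of d,   *)
(* and [delbar] that of type (p, q + 1).                                      *)
Definition del (A : components M) (k : nat) (f : kform k) : kform k.+1 :=
  fun a x v =>
    \sum_(p < k.+1) type_part A p.+1 (ext_d (type_part A p f)) a x v.

Definition delbar (A : components M) (k : nat) (f : kform k) : kform k.+1 :=
  fun a x v =>
    \sum_(p < k.+1) type_part A p (ext_d (type_part A p f)) a x v.

(* The complex bilinear extension of g(u, A v). *)
Definition form_of (g A : components M) : kform 2 :=
  fun a x v =>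
    ((col 0 v)^T *m to_C (g a x) *m to_C (A a x) *m col 1 v) 0 0.

End Forms.

Arguments wedge_pow {R m M k} f n.

Section HKT.
Context {R : realType} {m : nat} {M : manifold R m} {H : hypercomplex M}.
Implicit Type g : quaternionic_hermitian H.

Definition omegaI g : kform M 2 := form_of (metric g) (cI H).
Definition omegaJ g : kform M 2 := form_of (metric g) (cJ H).
Definition omegaK g : kform M 2 := form_of (metric g) (cK H).

Definition Omega g : kform M 2 :=
  form_add (omegaJ g) (form_scale 'i (omegaK g)).

Definition HKT g : Prop := form_eq0 (del (cI H) (Omega g)).

End HKT.

(* A Hermitian structure on a manifold of complex dimension d enters only     *)
(* through its Hermitian form w.                                              *)
Definition balanced (R : realType) (m : nat) (M : manifold R m)
    (d : nat) (w : kform M 2) : Prop :=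
  form_eq0 (ext_d (wedge_pow w d.-1)).

(* Main.v *)
From mathcomp Require Import all_boot all_order all_algebra all_fingroup.
From mathcomp Require Import all_classical all_reals all_analysis.
From mathcomp Require Import complex ring lra zify.
Require Import Defs.

(** Every condition can be tested at one point of one chart.  Fix there a
    torsion-free connection D that preserves I, J and K: the Obata connection,
    which the vanishing Nijenhuis tensors provide through an explicit formula
    ([obata_exists]).  The metric g need not be D-parallel; its failure is the
    family of endomorphisms E_u = g^-1 (D_u g), which are g-self-adjoint and
    commute with I, J and K.

    Both Omega and omega_I have the form g(-, A -) with A parallel, so D_u acts
    on their powers as the infinitesimal linear transformation E_u / 2, and as D
    is torsion-free, d of such a power is the alternation of this action
    ([ext_d_frame]).  Write tr E for the 1-form u |-> tr E_u and div E for the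
    1-form u |-> tr (w |-> E_w u).

    - Omega^n is a form of top degree on T^(1,0), and the trace of E_u on
      T^(1,0) is half of tr E_u; hence D_u (Omega^n) = (tr E_u / 4) Omega^n
      ([gl_act_Om]).  So D (Omega^n) = 0 means tr E = 0.  The (0,1)-part of this
      derivative is delbar (Omega^n), so delbar (Omega^n) = 0 means that tr E
      vanishes on T^(0,1) ([delbar_trace]), which is the same because tr E is
      real.

    - omega_I^(2n-1) is, up to a nonzero constant, the contraction of the volume
      form with the bivector inverse to omega_I.  Its differential is therefore
      a divergence, and it vanishes if and only if tr E = 2 div E
      ([ext_diff_wedge_expn_eq0P]).

    - The HKT condition is a cyclic identity on T^(1,0).  Contracting two of its
      three arguments with the inverse of Omega gives tr E = 4 div E
      ([hkt_trace]).

    By the last two items balancedness of an HKT metric amounts to tr E = 0,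
    which is the condition found for Omega^n. *)

Set Implicit Arguments.
Unset Strict Implicit.
Unset Printing Implicit Defensive.

Import Order.TTheory GRing.Theory Num.Theory numFieldNormedType.Exports.
Local Open Scope ring_scope.

(** * Multilinear alternating forms on column vectors *)

Section MultilinearForms.
Variable C : numFieldType.

Definition set_col N k (v : 'M[C]_(N, k)) (i : 'I_k) (u : 'cV[C]_N) : 'M[C]_(N, k) :=
  \matrix_(p, q) (if q == i then u p 0 else v p q).

Definition multilinear N k (f : 'M[C]_(N, k) -> C) : Prop :=
  forall v i a u w,
    f (set_col v i (a *: u + w)) = a * f (set_col v i u) + f (set_col v i w).

Definition alternating N k (f : 'M[C]_(N, k) -> C) : Prop :=
  forall (s : 'S_k) v, f (col_perm s v) = (-1) ^+ s * f v.

(** The derivation by which the endomorphism X, an element of the Lie algebra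
    gl_N, acts on forms (up to the usual sign). *)
Definition gl_act N k (X : 'M[C]_N) (f : 'M[C]_(N, k) -> C) : 'M[C]_(N, k) -> C :=
  fun v => \sum_(i < k) f (set_col v i (X *m col i v)).

Definition wedge_at N k l (f : 'M[C]_(N, k) -> C) (h : 'M[C]_(N, l) -> C) :
    'M[C]_(N, k + l) -> C :=
  fun v => ((k`! * l`!)%N%:R)^-1 *
    \sum_(s : 'S_(k + l))
      (-1) ^+ s * (f (lsubmx (col_perm s v)) * h (rsubmx (col_perm s v))).

Definition bilin N (W : 'M[C]_N) : 'M[C]_(N, 2) -> C :=
  fun v => ((col 0 v)^T *m W *m col 1 v) 0 0.

Fixpoint wedge_expn N (W : 'M[C]_N) (k : nat) : 'M[C]_(N, k * 2) -> C :=
  match k return 'M[C]_(N, k * 2) -> C with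
  | 0 => fun _ => 1
  | k'.+1 => wedge_at (bilin W) (@wedge_expn N W k')
  end.

(** The derivative of the k-th wedge power at W in the direction B, by the
    product rule. *)
Fixpoint wedge_expn_dir N (W B : 'M[C]_N) (k : nat) : 'M[C]_(N, k * 2) -> C :=
  match k return 'M[C]_(N, k * 2) -> C with
  | 0 => fun _ => 0
  | k'.+1 => fun v => wedge_at (bilin B) (@wedge_expn N W k') v
                      + wedge_at (bilin W) (@wedge_expn_dir N W B k') v
  end.

Lemma set_col_id N k (v : 'M[C]_(N, k)) i : set_col v i (col i v) = v.
Proof. by apply/matrixP=> p q; rewrite !mxE; case: eqP => [->|]. Qed.

Lemma col_set_col N k (v : 'M[C]_(N, k)) i u : col i (set_col v i u) = u.
Proof. by apply/matrixP=> p q; rewrite !mxE eqxx ord1. Qed.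

Lemma col_set_col_neq N k (v : 'M[C]_(N, k)) i j u :
  j != i -> col j (set_col v i u) = col j v.
Proof. by move=> /negPf ji; apply/matrixP=> p q; rewrite !mxE ji. Qed.

Lemma set_col_set_col N k (v : 'M[C]_(N, k)) i u w : set_col (set_col v i u) i w =
  set_col v i w.
Proof. by apply/matrixP=> p q; rewrite !mxE; case: eqP. Qed.

Lemma set_colC N k (v : 'M[C]_(N, k)) i j u w :
  i != j -> set_col (set_col v i u) j w = set_col (set_col v j w) i u.
Proof.
move=> ij; apply/matrixP=> p q; rewrite !mxE.
by case: eqP => [->|//]; rewrite eq_sym (negPf ij).
Qed.

Lemma col_perm_set_col N k (s : 'S_k) (v : 'M[C]_(N, k)) i u :
  col_perm s (set_col v (s i) u) = set_col (col_perm s v) i u.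
Proof. by apply/matrixP=> p q; rewrite !mxE (inj_eq perm_inj). Qed.

Lemma mulmx_set_col N M k (P : 'M[C]_(M, N)) (v : 'M[C]_(N, k)) i u :
  P *m set_col v i u = set_col (P *m v) i (P *m u).
Proof.
apply/matrixP=> p q; rewrite !mxE; case: eqP => [->|/eqP qi]; apply: eq_bigr => r _.
  by rewrite mxE eqxx.
by rewrite mxE (negPf qi).
Qed.

Section Multilinear.
Variables (N k : nat) (f : 'M[C]_(N, k) -> C).
Hypothesis fm : multilinear f.

Lemma multilinear0 v i : f (set_col v i 0) = 0.
Proof.
have := fm v i 1 0 0; rewrite scaler0 addr0 mul1r => /eqP.
by rewrite -subr_eq subrr eq_sym => /eqP.
Qed.

Lemma multilinearZ v i a u : f (set_col v i (a *: u)) = a * f (set_col v i u).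
Proof. by have := fm v i a u 0; rewrite multilinear0 !addr0. Qed.

Lemma multilinearD v i u w : f (set_col v i (u + w)) = f (set_col v i u) + f (set_col v
  i w).
Proof. by have := fm v i 1 u w; rewrite scale1r mul1r. Qed.

Lemma multilinear_sum (I : Type) (r : seq I) (P : pred I) v i (u : I -> 'cV[C]_N) :
  f (set_col v i (\sum_(a <- r | P a) u a)) = \sum_(a <- r | P a) f (set_col v i (u a)).
Proof.
by elim/big_rec2: _ => [|a x y _ IH]; rewrite ?multilinear0 // multilinearD IH.
Qed.

Lemma multilinear_col0 v i : col i v = 0 -> f v = 0.
Proof. by move=> v0; rewrite -(set_col_id v i) v0 multilinear0. Qed.

End Multilinear.

Lemma col_sum N (u : 'cV[C]_N) : u = \sum_(j < N) u j 0 *: delta_mx j 0.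
Proof.
apply/matrixP=> p q; rewrite ord1 summxE (bigD1 p) //= !mxE !eqxx mulr1.
by rewrite big1 ?addr0 // => j jp; rewrite !mxE eq_sym (negPf jp) mulr0.
Qed.

(** The columns are expanded one at a time: the induction is on the number d
    of leading columns that are still arbitrary. *)
Lemma multilinear_basis_eq0 N k (f : 'M[C]_(N, k) -> C) : multilinear f ->
  (forall phi : 'I_k -> 'I_N, f (colsub phi 1%:M) = 0) -> forall v, f v = 0.
Proof.
move=> fm f0 v.
suff: forall d, (d <= k)%N -> forall w : 'M[C]_(N, k),
    (forall j : 'I_k, (d <= j)%N -> exists b, col j w = delta_mx b 0) -> f w = 0.
  by apply; [exact: leqnn | move=> j; rewrite leqNgt ltn_ord].
elim=> [_ w wb|d IH dk w wb].
  have /fin_all_exists [phi phiP] : forall j : 'I_k, exists b, col j w = delta_mx b 0.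
    by move=> j; apply: wb.
  rewrite -[RHS](f0 phi); congr f; apply/matrixP=> p q.
  by have /matrixP/(_ p 0) := phiP q; rewrite !mxE eqxx andbT.
pose i := Ordinal dk.
rewrite -(set_col_id w i) [col i w]col_sum multilinear_sum //; apply: big1 => b _.
rewrite multilinearZ // [X in _ * X]IH ?mulr0 //; first exact: ltnW.
move=> j; rewrite leq_eqVlt => /orP[/eqP dj|dj].
  have -> : j = i by apply: val_inj.
  by exists b; rewrite col_set_col.
have [b' wb'] := wb j dj; exists b'; rewrite col_set_col_neq //.
by apply: contraTneq dj => ->; rewrite ltnn.
Qed.

Lemma alternating_eq_col0 N k (f : 'M[C]_(N, k) -> C) : alternating f ->
  forall v i j, i != j -> col i v = col j v -> f v = 0.
Proof.
move=> fa v i j ij vij; have := fa (tperm i j) v.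
rewrite odd_tperm ij expr1 mulN1r.
have -> : col_perm (tperm i j) v = v.
  apply/matrixP=> p q; rewrite !mxE; case: tpermP => // ->.
    by have /matrixP/(_ p 0) := vij; rewrite !mxE.
  by have /matrixP/(_ p 0) := vij; rewrite !mxE.
move=> /eqP; rewrite -addr_eq0 -mulr2n -mulr_natl mulf_eq0 pnatr_eq0 /=.
by move/eqP.
Qed.

(** Top forms are proportional to the determinant. Evaluated on basis vectors,
    such a form either sees a repeated column or a permutation of the
    identity. *)
Lemma top_form_eq0 N (f : 'M[C]_N -> C) : multilinear f -> alternating f ->
  f 1%:M = 0 -> forall v, f v = 0.
Proof.
move=> fm fa f1; apply: multilinear_basis_eq0 => // phi.
have [inj_phi|ninj] := boolP (injectiveb phi).
  have -> : colsub phi 1%:M = col_perm (perm (injectiveP _ inj_phi)) 1%:M :> 'M[C]_N.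
    by apply/matrixP=> p q; rewrite !mxE permE.
  by rewrite fa f1 mulr0.
have [i [j ij phi_ij]] := injectivePn _ ninj.
by apply: (alternating_eq_col0 fa ij); apply/matrixP=> p q; rewrite !mxE phi_ij.
Qed.

Lemma gl_act_multilinear N k (X : 'M[C]_N) (f : 'M[C]_(N, k) -> C) : multilinear f ->
  multilinear (gl_act X f).
Proof.
move=> fm v i a u w; rewrite /gl_act mulr_sumr -big_split /=; apply: eq_bigr => j _.
have [->|ji] := eqVneq j i; first by rewrite !col_set_col !set_col_set_col mulmxDr
  -scalemxAr fm.
by rewrite !col_set_col_neq // !(set_colC _ _ _ (_ : i != j)) 1?eq_sym // fm.
Qed.

Lemma gl_act_alt N k (X : 'M[C]_N) (f : 'M[C]_(N, k) -> C) :
  alternating f -> alternating (gl_act X f).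
Proof.
move=> fa s v; rewrite /gl_act mulr_sumr [RHS](reindex_inj (@perm_inj _ s)) /=.
apply: eq_bigr => i _; rewrite -fa col_perm_set_col; congr (f (set_col _ _ (_ *m _))).
by apply/matrixP=> p q; rewrite !mxE.
Qed.

(** Only the diagonal coefficient of X e_i survives in the i-th term, the
    others repeating a column. *)
Lemma gl_act_top1 N (X : 'M[C]_N) (f : 'M[C]_N -> C) : multilinear f -> alternating f ->
  gl_act X f 1%:M = \tr X * f 1%:M.
Proof.
move=> fm fa; rewrite /gl_act /mxtrace mulr_suml; apply: eq_bigr => i _.
rewrite [col i 1%:M]colE mul1mx -colE (col_sum (col i X)) multilinear_sum // (bigD1 i)
  //= big1 => [|j ji].
  rewrite addr0 multilinearZ // mxE; congr (_ * f _).
  by apply/matrixP=> p q; rewrite !mxE; case: eqP => [->|//]; rewrite andbT.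
rewrite multilinearZ // (alternating_eq_col0 fa ji) ?mulr0 // col_set_col
  col_set_col_neq //.
by apply/matrixP=> p q; rewrite !mxE (ord1 q) andbT.
Qed.

(** Both sides are top forms, so it suffices to compare them on the standard
    basis. *)
Lemma gl_act_top N (X : 'M[C]_N) (f : 'M[C]_N -> C) : multilinear f -> alternating f ->
  forall v, gl_act X f v = \tr X * f v.
Proof.
move=> fm fa v; apply/eqP; rewrite -subr_eq0; apply/eqP; move: v.
apply: (@top_form_eq0 N (fun v => gl_act X f v - \tr X * f v)).
- move=> v i a u w; rewrite (gl_act_multilinear X fm) fm mulrDr mulrBr opprD addrACA.
  by rewrite mulrCA.
- by move=> s v; rewrite (gl_act_alt X fa) fa mulrBr mulrCA.
- by rewrite gl_act_top1 // subrr.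
Qed.

End MultilinearForms.

(** * Wedge products and powers of two-forms *)

Section Wedge.
Variable C : numFieldType.

Lemma lsubmx_set_col_lshift N k l (v : 'M[C]_(N, k + l)) i u :
  lsubmx (set_col v (lshift l i) u) = set_col (lsubmx v) i u.
Proof. by apply/matrixP=> p q; rewrite !mxE (inj_eq (@lshift_inj _ _)). Qed.

Lemma rsubmx_set_col_lshift N k l (v : 'M[C]_(N, k + l)) i u :
  rsubmx (set_col v (lshift l i) u) = rsubmx v.
Proof. by apply/matrixP=> p q; rewrite !mxE eq_rlshift. Qed.

Lemma lsubmx_set_col_rshift N k l (v : 'M[C]_(N, k + l)) i u :
  lsubmx (set_col v (rshift k i) u) = lsubmx v.
Proof. by apply/matrixP=> p q; rewrite !mxE eq_lrshift. Qed.

Lemma rsubmx_set_col_rshift N k l (v : 'M[C]_(N, k + l)) i u :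
  rsubmx (set_col v (rshift k i) u) = set_col (rsubmx v) i u.
Proof. by apply/matrixP=> p q; rewrite !mxE (inj_eq (@rshift_inj _ _)). Qed.

Lemma col_lsubmx N k l (v : 'M[C]_(N, k + l)) i :
  col i (lsubmx v) = col (lshift l i) v.
Proof. by apply/matrixP=> p q; rewrite !mxE. Qed.

Lemma wedge_at_multilinear N k l (f : 'M[C]_(N, k) -> C) (h : 'M[C]_(N, l) -> C) :
  multilinear f -> multilinear h -> multilinear (wedge_at f h).
Proof.
move=> fm hm v i a u w; rewrite /wedge_at mulrCA -mulrDr; congr (_ * _).
rewrite mulr_sumr -big_split; apply: eq_bigr => s _ /=.
have [j ->] : exists j, i = s j by exists ((s^-1)%g i); rewrite permKV.
rewrite !col_perm_set_col; case: (split_ordP j) => q ->.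
  by rewrite !lsubmx_set_col_lshift !rsubmx_set_col_lshift fm mulrDl mulrDr -mulrA;
    congr (_ + _); rewrite mulrCA.
by rewrite !lsubmx_set_col_rshift !rsubmx_set_col_rshift hm !mulrDr; congr (_ + _);
  rewrite !(mulrCA _ a).
Qed.

Lemma wedge_at_alt N k l (f : 'M[C]_(N, k) -> C) (h : 'M[C]_(N, l) -> C) :
  alternating (wedge_at f h).
Proof.
move=> t v; rewrite /wedge_at mulrCA; congr (_ * _).
rewrite mulr_sumr (reindex_inj (mulIg t^-1%g)) /=; apply: eq_bigr => s _.
by rewrite -col_permM -mulgA mulVg mulg1 odd_permM odd_permV signr_addb -mulrA mulrCA.
Qed.

(** The Leibniz rule: a column moved by X lands in one of the two factors. *)
Lemma gl_act_wedge_at N k l (X : 'M[C]_N) (f : 'M[C]_(N, k) -> C) (h : 'M[C]_(N, l) ->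
  C) v :
  gl_act X (wedge_at f h) v = wedge_at (gl_act X f) h v + wedge_at f (gl_act X h) v.
Proof.
rewrite /wedge_at -mulrDr /gl_act -mulr_sumr exchange_big -big_split /=; congr (_ * _).
apply: eq_bigr => s _; rewrite -mulr_sumr -mulrDr; congr (_ * _).
rewrite (reindex_inj (@perm_inj _ s)) big_split_ord /= mulr_suml mulr_sumr.
congr (_ + _); apply: eq_bigr => i _; rewrite !col_perm_set_col.
  rewrite lsubmx_set_col_lshift rsubmx_set_col_lshift; congr (f (set_col _ _ (X *m _))
    * _).
  by apply/matrixP=> p q; rewrite !mxE.
rewrite lsubmx_set_col_rshift rsubmx_set_col_rshift; congr (_ * h (set_col _ _ (X *m
  _))).
by apply/matrixP=> p q; rewrite !mxE.
Qed.

Lemma eq_wedge_at N k l (f f' : 'M[C]_(N, k) -> C) (h h' : 'M[C]_(N, l) -> C) :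
  f =1 f' -> h =1 h' -> wedge_at f h =1 wedge_at f' h'.
Proof.
by move=> ff hh v; rewrite /wedge_at; congr (_ * _); apply: eq_bigr => s _; rewrite ff
  hh.
Qed.

Lemma wedge_at_mulmx N M k l (P : 'M[C]_(N, M)) (f : 'M[C]_(N, k) -> C)
    (h : 'M[C]_(N, l) -> C) v :
  wedge_at f h (P *m v) = wedge_at (fun w => f (P *m w)) (fun w => h (P *m w)) v.
Proof.
rewrite /wedge_at; congr (_ * _); apply: eq_bigr => s _.
by rewrite !col_permE -mulmxA mulmx_lsub mulmx_rsub.
Qed.

Lemma wedge_atZl N k l c (f : 'M[C]_(N, k) -> C) (h : 'M[C]_(N, l) -> C) v :
  wedge_at (fun w => c * f w) h v = c * wedge_at f h v.
Proof.
rewrite /wedge_at [RHS]mulrCA [c * _]mulr_sumr; congr (_ * _); apply: eq_bigr => s _ /=.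
by rewrite -mulrA mulrCA.
Qed.

Lemma wedge_at_bilin_suml N k (I : finType) (W : I -> 'M[C]_N) (h : 'M[C]_(N, k) -> C)
  v :
  wedge_at (bilin (\sum_i W i)) h v = \sum_i wedge_at (bilin (W i)) h v.
Proof.
rewrite /wedge_at -mulr_sumr exchange_big; congr (_ * _); apply: eq_bigr => s _ /=.
rewrite -mulr_sumr -mulr_suml; congr (_ * (_ * _)).
by rewrite /bilin mulmx_sumr mulmx_suml summxE.
Qed.

Lemma bilin_multilinear N (W : 'M[C]_N) : multilinear (bilin W).
Proof.
move=> v i a u w; rewrite /bilin; case: (split_ordP (i : 'I_(1 + 1))) => j ->;
  rewrite (ord1 j).
  have -> : lshift 1 (0 : 'I_1) = 0 :> 'I_2 by apply: val_inj.
  rewrite !col_set_col !col_set_col_neq // linearD /= linearZ /= !mulmxDl -!scalemxAl.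
  by rewrite !mxE.
have -> : rshift 1 (0 : 'I_1) = 1 :> 'I_2 by apply: val_inj.
by rewrite !col_set_col !col_set_col_neq // mulmxDr -scalemxAr !mxE.
Qed.

Lemma col_mulmx N M k (P : 'M[C]_(M, N)) (v : 'M[C]_(N, k)) i :
  col i (P *m v) = P *m col i v.
Proof. by rewrite !colE mulmxA. Qed.

Lemma bilin_mulmx N M (P : 'M[C]_(N, M)) (W : 'M[C]_N) v :
  bilin W (P *m v) = bilin (P^T *m W *m P) v.
Proof. by rewrite /bilin !col_mulmx trmx_mul !mulmxA. Qed.

Lemma gl_act_bilin N (X W : 'M[C]_N) v : gl_act X (bilin W) v = bilin (X^T *m W + W *m
  X) v.
Proof.
rewrite /gl_act big_ord_recl big_ord1 /bilin.
have -> : lift ord0 0 = 1 :> 'I_2 by apply: val_inj.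
rewrite !col_set_col !col_set_col_neq //.
by rewrite trmx_mul mulmxDr mulmxDl !mulmxA [RHS]mxE.
Qed.

Lemma ord2_neq0 (j : 'I_2) : j != 0 -> j = 1.
Proof. by case: j => [[|[|?]] ?] //= _; apply: val_inj. Qed.

Lemma bilin_alt N (W : 'M[C]_N) : W^T = - W -> alternating (bilin W).
Proof.
move=> Wa s v; have bilC (u w : 'cV[C]_N) : (u^T *m W *m w) 0 0 = - (w^T *m W *m u) 0 0.
  transitivity ((u^T *m W *m w)^T 0 0); first by rewrite [RHS]mxE.
  by rewrite !trmx_mul trmxK Wa mulNmx mulmxN mulmxA [LHS]mxE.
have cs j : col j (col_perm s v) = col (s j) v.
  by apply/matrixP=> p q; rewrite !mxE.
rewrite /bilin !cs.
have [s0|s0] := eqVneq (s 0) 0.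
  have s1 : s = 1%g.
    apply/permP=> j; rewrite perm1.
    have [->|j0] := eqVneq j 0; first by rewrite s0.
    rewrite (ord2_neq0 j0) (@ord2_neq0 (s 1)) //.
    by rewrite -s0 (inj_eq perm_inj).
  by rewrite s1 !perm1 odd_perm1 mul1r.
have s1 : s = tperm 0 1.
  have s01 : s 0 = 1 by apply: ord2_neq0.
  have s10 : s 1 = 0.
    have : s 1 != s 0 by rewrite (inj_eq perm_inj).
    by rewrite s01; apply: contraNeq => /ord2_neq0 ->.
  apply/permP=> j.
  have [->|j0] := eqVneq j 0; first by rewrite tpermL.
  by rewrite (ord2_neq0 j0) tpermR.
by rewrite s1 tpermL tpermR odd_tperm bilC /= expr1 mulN1r.
Qed.

Lemma wedge_expn_multilinear N (W : 'M[C]_N) k : multilinear (@wedge_expn C N W k).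
Proof.
elim: k => [|k IH]; first by move=> v [].
exact: wedge_at_multilinear (bilin_multilinear W) IH.
Qed.

Lemma wedge_expn_alt N (W : 'M[C]_N) k : alternating (@wedge_expn C N W k).
Proof.
case: k => [|k]; last exact: wedge_at_alt.
move=> s v /=; have -> : s = 1%g by apply/permP=> - [].
by rewrite odd_perm1 mulr1.
Qed.

Lemma wedge_expn_mulmx N M (P : 'M[C]_(N, M)) (W : 'M[C]_N) k v :
  @wedge_expn C N W k (P *m v) = @wedge_expn C M (P^T *m W *m P) k v.
Proof.
elim: k v => //= k IH v; rewrite wedge_at_mulmx; apply: eq_wedge_at => // w.
exact: bilin_mulmx.
Qed.

Lemma wedge_expn_dir0 N (W : 'M[C]_N) k v : @wedge_expn_dir C N W 0 k v = 0.
Proof.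
elim: k v => //= k IH v; rewrite /wedge_at !big1 ?mulr0 ?addr0 // => s _.
  by rewrite IH !mulr0.
by rewrite /bilin mulmx0 mul0mx mxE mul0r mulr0.
Qed.

(** The action of X on a power of W differentiates this power along the action
    of X on W. Prescribing the derivative of W thus determines that of all its
    powers. *)
Lemma gl_act_wedge_expn N (X W : 'M[C]_N) k v :
  gl_act X (@wedge_expn C N W k) v = @wedge_expn_dir C N W (X^T *m W + W *m X) k v.
Proof.
elim: k v => [v|k IH v]; first by rewrite /gl_act big_ord0.
rewrite [LHS](gl_act_wedge_at X (bilin W) (@wedge_expn C N W k) v) /=.
by congr (_ + _); apply: eq_wedge_at => // w; exact: gl_act_bilin.
Qed.

(** Permutations are sorted according to the image i of the first index;
    [lift_perm] identifies each class with the permutations of the remaining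
    indices and contributes the sign (-1)^i. This is how index deletions are
    exchanged for sums over permutations. *)
Lemma sum_perm_cofactor N k (Psi : 'M[C]_(N, k.+1) -> C) (v : 'M[C]_(N, k.+1)) :
  \sum_(s : 'S_k.+1) (-1) ^+ s * Psi (col_perm s v) =
  \sum_(i < k.+1) (-1) ^+ i * \sum_(t : 'S_k) (-1) ^+ t *
    Psi (row_mx (col i v) (col_perm t (col' i v)) : 'M[C]_(N, 1 + k)).
Proof.
rewrite (partition_big (fun s : 'S_k.+1 => s ord0) xpredT) //=.
apply: eq_bigr => i _; rewrite mulr_sumr (reindex (lift_perm ord0 i)); last first.
  pose drp (s : 'S_k.+1) j q := odflt q (unlift (s j) (s (lift j q))).
  have drpK j (s : 'S_k.+1) q : lift (s j) (drp s j q) = s (lift j q).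
    rewrite /drp; have := neq_lift j q.
    by rewrite -(can_eq (permK s)) => /unlift_some[] ? ? ->.
  have drp_inj (s : 'S_k.+1) : injective (drp s ord0).
    apply: can_inj (drp s^-1%g (s ord0)) _ => q.
    by rewrite {1}/drp drpK !permK liftK.
  exists (fun s => perm (@drp_inj s)) => [s _ | s].
    by apply/permP=> q; rewrite permE /drp lift_perm_lift lift_perm_id liftK.
  move/(s _ =P _) => s0; apply/permP=> q.
  case: (unliftP ord0 q) => [q'|] ->; rewrite ?lift_perm_id //.
  by rewrite lift_perm_lift -s0 permE drpK.
apply: eq_big => [t|t _]; first by rewrite lift_perm_id eqxx.
rewrite odd_lift_perm /= signr_addb signr_odd -mulrA; congr (_ * (_ * Psi _)).
apply/matrixP=> p q; rewrite !mxE; case: (split_ordP (q : 'I_(1 + k))) => j ->.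
  rewrite (ord1 j) !mxE (_ : lshift k 0 = ord0) ?lift_perm_id //.
  exact: val_inj.
rewrite !mxE (_ : rshift 1 j = lift ord0 j) ?lift_perm_lift //.
exact: val_inj.
Qed.

End Wedge.

(** * The penultimate power of a symplectic form as a bivector *)

Section Symplectic.
Variable C : numFieldType.

Lemma alternating_sum N k (F : 'M[C]_(N, k) -> C) v : alternating F ->
  \sum_(t : 'S_k) (-1) ^+ t * F (col_perm t v) = k`!%:R * F v.
Proof.
move=> Fa; under eq_bigr do rewrite Fa mulrA -signr_addb addbb mul1r.
by rewrite sumr_const card_Sn mulr_natl.
Qed.

Lemma bilin_rank1 N (b0 b1 : 'rV[C]_N) u :
  bilin (b0^T *m b1) u = (b0 *m col 0 u) 0 0 * (b1 *m col 1 u) 0 0.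
Proof.
rewrite /bilin !mulmxA -trmx_mul -mulmxA mxE big_ord1; congr (_ * _).
by rewrite [LHS]mxE.
Qed.

Lemma lsubmx_row0 N k (y : 'cV[C]_N) (u : 'M[C]_(N, 1 + k)) :
  col 0 (lsubmx (row_mx y u : 'M[C]_(N, 2 + k))) = y.
Proof.
apply/matrixP=> p q; rewrite !mxE.
case: (split_ordP (lshift k (0 : 'I_2) : 'I_(1 + k.+1))) => j; last by case/(congr1
  val).
by rewrite (ord1 j) (ord1 q).
Qed.

Lemma lsubmx_row1 N k (y : 'cV[C]_N) (u : 'M[C]_(N, 1 + k)) :
  col 1 (lsubmx (row_mx y u : 'M[C]_(N, 2 + k))) = lsubmx u.
Proof.
apply/matrixP=> p q; rewrite !mxE.
case: (split_ordP (lshift k (1 : 'I_2) : 'I_(1 + k.+1))) => j.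
  by rewrite (ord1 j) => /(congr1 val).
by move/(congr1 val) => jv; congr (u p _); apply/val_inj/(@addnI 1); rewrite -[LHS]jv
  (ord1 q).
Qed.

Lemma rsubmx_row2 N k (y : 'cV[C]_N) (u : 'M[C]_(N, 1 + k)) :
  rsubmx (row_mx y u : 'M[C]_(N, 2 + k)) = rsubmx u.
Proof.
apply/matrixP=> p q; rewrite !mxE.
case: (split_ordP (rshift 2 q : 'I_(1 + k.+1))) => j.
  by rewrite (ord1 j) => /(congr1 val).
by move/(congr1 val) => jv; congr (u p _); apply/val_inj/(@addnI 1); rewrite -[LHS]jv.
Qed.

Lemma col'0_row N k (y : 'cV[C]_N) (u : 'M[C]_(N, k)) :
  col' (0 : 'I_k.+1) (row_mx y u : 'M[C]_(N, 1 + k)) = u.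
Proof.
apply/matrixP=> p q; rewrite mxE.
have -> : lift 0 q = rshift 1 q :> 'I_(1 + k) by apply: val_inj.
exact: row_mxEr.
Qed.

Lemma col0_row N k (y : 'cV[C]_N) (u : 'M[C]_(N, k)) :
  col (0 : 'I_k.+1) (row_mx y u : 'M[C]_(N, 1 + k)) = y.
Proof.
apply/matrixP=> p q; rewrite mxE.
have -> : 0 = lshift k 0 :> 'I_(1 + k) by apply: val_inj.
by rewrite (ord1 q); exact: row_mxEl.
Qed.

Lemma colS_row N k (y : 'cV[C]_N) (u : 'M[C]_(N, k)) i :
  col (lift 0 i : 'I_k.+1) (row_mx y u : 'M[C]_(N, 1 + k)) = col i u.
Proof.
apply/matrixP=> p q; rewrite !mxE.
case: (split_ordP (lift 0 i : 'I_(1 + k))) => j.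
  by rewrite (ord1 j) => /(congr1 val).
by move/(congr1 val) => jv; congr (u p _); apply/val_inj/(@addnI 1); rewrite -[LHS]jv.
Qed.

(** With vectors dual to the covectors b0 and b1, only the permutations that
    fix the first two indices contribute. So a form can be recovered from its
    products with two-forms of rank one. *)
Lemma wedge_at_rank1 N k (b0 b1 : 'rV[C]_N) (F : 'M[C]_(N, k) -> C)
    (y0 y1 : 'cV[C]_N) (v : 'M[C]_(N, k)) :
  alternating F -> (b0 *m y0) 0 0 = 1 -> (b1 *m y1) 0 0 = 1 ->
  b0 *m y1 = 0 -> b0 *m v = 0 -> b1 *m v = 0 ->
  wedge_at (bilin (b0^T *m b1)) F (row_mx y0 (row_mx y1 v) : 'M[C]_(N, 1 + (1 + k))) =
  2^-1 * F v.
Proof.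
move=> Fa b00 b11 b01 b0v b1v.
pose Psi (u : 'M[C]_(N, 2 + k)) := bilin (b0^T *m b1) (lsubmx u) * F (rsubmx u).
rewrite /wedge_at [X in _ * X](sum_perm_cofactor Psi) big_ord_recl [X in _ + X]big1 =>
  [|i _].
  rewrite addr0 expr0 mul1r col0_row col'0_row.
  pose Psi1 (u : 'M[C]_(N, 1 + k)) := Psi (row_mx y0 u : 'M[C]_(N, 1 + (1 + k))).
  rewrite [X in _ * X](sum_perm_cofactor Psi1) big_ord_recl [X in _ + X]big1 => [|i _].
    rewrite addr0 expr0 mul1r col0_row col'0_row /Psi1 /Psi.
    under eq_bigr do rewrite bilin_rank1 lsubmx_row0 lsubmx_row1 rsubmx_row2
      row_mxKl row_mxKr b00 b11 !mul1r.
    rewrite alternating_sum // natrM invfM -mulrA; congr (_ * _).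
    by rewrite mulKf // pnatr_eq0 -lt0n fact_gt0.
  rewrite big1 ?mulr0 // => t _; rewrite /Psi1 /Psi bilin_rank1 lsubmx_row1 row_mxKl.
  by rewrite colS_row -(col_mulmx b1 v) b1v !mxE mulr0 mul0r mulr0.
rewrite big1 ?mulr0 // => t _; rewrite /Psi bilin_rank1 lsubmx_row0 colS_row.
have -> : b0 *m col i (row_mx y1 v) = 0.
  transitivity (col i (b0 *m (row_mx y1 v : 'M[C]_(N, 1 + k)))); first
    exact/esym/col_mulmx.
  by rewrite mul_mx_row b01 b0v row_mx0 col0.
by rewrite mxE !mul0r mulr0.
Qed.

Lemma antisym_diag N (A : 'M[C]_N) : A^T = - A -> forall i, A i i = 0.
Proof.
move=> Aa i; have /matrixP/(_ i i) := Aa; rewrite !mxE => /eqP.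
by rewrite -addr_eq0 -mulr2n -mulr_natl mulf_eq0 pnatr_eq0 /= => /eqP.
Qed.

Lemma trmx_inv_antisym N (W : 'M[C]_N) : W^T = - W -> W \in unitmx ->
  (invmx W)^T = - invmx W.
Proof.
move=> Wa Wu; rewrite trmx_inv Wa -scaleN1r invmxZ ?unitmxZ ?unitrN1 //.
by rewrite invrN invr1 scaleN1r.
Qed.

Lemma mxtrace_delta N (A : 'M[C]_N) i j : \tr (A *m delta_mx i j) = A j i.
Proof.
rewrite /mxtrace (bigD1 j) //= big1 => [|l lj].
  rewrite addr0 mxE (bigD1 i) //= big1 => [|l li]; first by rewrite mxE !eqxx mulr1
    addr0.
  by rewrite mxE (negPf li) mulr0.
by rewrite mxE big1 // => r _; rewrite mxE (negPf lj) andbF mulr0.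
Qed.

(** Commuting with the symmetric elementary matrices forces Z to be diagonal
    with equal entries. *)
Lemma symm_comm_scalar N (Z : 'M[C]_N.+1) :
  (forall S : 'M[C]_N.+1, S^T = S -> S *m Z = Z *m S) -> Z = (Z 0 0)%:M.
Proof.
move=> ZS; have eD i j (A : 'M[C]_N.+1) p q :
    (delta_mx i j *m A) p q = (p == i)%:R * A j q.
  rewrite mxE (bigD1 j) //= big1 => [|l lj]; first by rewrite mxE eqxx andbT addr0.
  by rewrite mxE (negPf lj) andbF mul0r.
have De i j (A : 'M[C]_N.+1) p q : (A *m delta_mx i j) p q = A p i * (q == j)%:R.
  rewrite mxE (bigD1 i) //= big1 => [|l li]; first by rewrite mxE eqxx addr0.
  by rewrite mxE (negPf li) mulr0.
apply/matrixP=> i j; rewrite [RHS]mxE; have [<-{j}|ij] := eqVneq i j.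
  have [->//|i0] := eqVneq i 0.
  have /ZS/matrixP/(_ i 0) : (delta_mx i 0 + delta_mx 0 i : 'M[C]_N.+1)^T
      = delta_mx i 0 + delta_mx 0 i by rewrite linearD /= !trmx_delta addrC.
  rewrite mulmxDl mulmxDr [LHS]mxE [RHS]mxE !eD !De eqxx [0 == i]eq_sym (negPf i0).
  by rewrite mul0r mulr0 mul1r mulr1 !addr0 mulr1n => ->.
have /ZS/matrixP/(_ i j) : (delta_mx i i : 'M[C]_N.+1)^T = delta_mx i i.
  by rewrite trmx_delta.
by rewrite eD De eqxx [j == i]eq_sym (negPf ij) mulr0 mul1r.
Qed.

(** The linear functional by which the power of degree N - 2 of W pairs with
    bilinear forms; it encodes this power as a bivector. *)
Definition top_pairing k (W : 'M[C]_(2 + k * 2)) (phi : 'M[C]_(2 + k * 2)) : C :=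
  wedge_at (bilin phi) (@wedge_expn C (2 + k * 2) W k) 1%:M.

Lemma top_pairing_trace k (W : 'M[C]_(2 + k * 2)) :
  exists L, forall phi, top_pairing W phi = \tr (L *m phi).
Proof.
exists (\matrix_(a, b) top_pairing W (delta_mx b a)) => phi.
rewrite {1}(matrix_sum_delta phi) /top_pairing wedge_at_bilin_suml.
rewrite /mxtrace; under [RHS]eq_bigr do rewrite mxE.
rewrite [RHS]exchange_big; apply: eq_bigr => i _ /=.
rewrite wedge_at_bilin_suml; apply: eq_bigr => j _; rewrite mxE mulrC -wedge_atZl.
by apply: eq_wedge_at => // w; rewrite /bilin -scalemxAr -scalemxAl mxE.
Qed.

(** The pairing is invariant under the symplectic Lie algebra of W, whose
    elements are the W^-1 S with S symmetric: these kill W, hence its powers,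
    and they have trace zero. Up to a scalar the only invariant bivector is
    W^-1. *)
Lemma top_pairing_inv k (W : 'M[C]_(2 + k * 2)) : W^T = - W -> W \in unitmx ->
  exists c, forall phi, top_pairing W phi = c * \tr (invmx W *m phi).
Proof.
move=> Wa Wu; have [L LE] := top_pairing_trace W.
have Winv := trmx_inv_antisym Wa Wu.
have LX S : S^T = S -> S *m (L *m W) = W *m L *m S.
  move=> Ss; pose X := invmx W *m S.
  have XT : X^T = - (S *m invmx W) by rewrite trmx_mul Winv Ss mulmxN.
  have XW : X^T *m W + W *m X = 0.
    by rewrite XT mulNmx mulmxKV // mulKVmx // addNr.
  have trX : \tr X = 0.
    have : \tr X = - \tr X by rewrite -[LHS]mxtrace_tr XT linearN /= mxtrace_mulC.
    by move/eqP; rewrite -addr_eq0 -mulr2n -mulr_natl mulf_eq0 pnatr_eq0 /= => /eqP.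
  have XE : X = invmx W *m S by []; clearbody X.
  have X0 phi : \tr (L *m (X^T *m phi + phi *m X)) = 0.
    rewrite -LE /top_pairing.
    transitivity (gl_act X (wedge_at (bilin phi) (@wedge_expn C (2 + k * 2) W k)) 1%:M).
      rewrite gl_act_wedge_at -[LHS]addr0; congr (_ + _).
        by apply: eq_wedge_at => // w; rewrite gl_act_bilin.
      rewrite /wedge_at big1 ?mulr0 // => s _.
      by rewrite gl_act_wedge_expn XW wedge_expn_dir0 !mulr0.
    rewrite gl_act_top1; first by rewrite trX mul0r.
      by apply: wedge_at_multilinear; [exact: bilin_multilinear | exact:
        wedge_expn_multilinear].
    exact: wedge_at_alt.
  have LX0 : L *m X^T + X *m L = 0.
    apply/matrixP=> i j; rewrite [RHS]mxE -mxtrace_delta -[RHS](X0 (delta_mx j i)).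
    rewrite mulmxDl mulmxDr !linearD /= !mulmxA; congr (_ + _).
    by rewrite [RHS]mxtrace_mulC mulmxA.
  have := congr1 (fun A => W *m A *m W) LX0.
  rewrite /= mulmx0 mul0mx XT XE mulmxDr mulmxDl !mulmxN mulNmx !mulmxA.
  rewrite mulmxKV // mulmxV // mul1mx => /eqP.
  by rewrite addrC subr_eq0 => /eqP.
have Z1 := LX _ (trmx1 _ _); rewrite mul1mx mulmx1 in Z1.
have : L *m W = ((L *m W) 0 0)%:M.
  by apply: symm_comm_scalar => S /LX; rewrite -Z1.
move: ((L *m W) 0 0) => c LW; exists c => phi.
by rewrite LE -[L](mulmxK Wu) LW mul_scalar_mx -scalemxAl linearZ.
Qed.

End Symplectic.

(** * Powers of a nondegenerate two-form do not vanish *)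

Section Symplectic.
Variable C : numFieldType.

Definition drop_cols k (a : 'I_k.+2) (b : 'I_k.+1) : 'M[C]_(k.+2, k) :=
  col' b (col' a 1%:M).

Lemma mul_drop_cols p k (a : 'I_k.+2) (b : 'I_k.+1) (A : 'M[C]_(p, k.+2)) i j :
  (A *m drop_cols a b) i j = A i (lift a (lift b j)).
Proof.
rewrite mxE (bigD1 (lift a (lift b j))) //= big1 => [|q qN].
  by rewrite !mxE eqxx mulr1 addr0.
by rewrite !mxE (negPf qN) mulr0.
Qed.

(** By Jacobi, the Pfaffian of W without the rows and columns a and b is, up
    to sign, that of W times the entry (a, b) of the inverse of W. Only the
    resulting nondegeneracy is established, through kernels. *)
Lemma drop_cols_unit k (W : 'M[C]_k.+2) a b : W^T = - W -> W \in unitmx ->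
  invmx W a (lift a b) != 0 ->
  (drop_cols a b)^T *m W *m drop_cols a b \in unitmx.
Proof.
move=> Wa Wu Wab; have Winv := trmx_inv_antisym Wa Wu.
set v := drop_cols a b; rewrite -row_free_unit; apply: inj_row_free => u.
rewrite !mulmxA; set y := u *m v^T *m W => yv.
have uv : u *m v^T = y *m invmx W by rewrite mulmxK.
have vE p q : v p q = (p == lift a (lift b q))%:R by rewrite !mxE.
have y0 q : y 0 (lift a (lift b q)) = 0.
  by rewrite -mul_drop_cols yv mxE.
have yE c : (y *m invmx W) 0 c = y 0 a * invmx W a c + y 0 (lift a b) * invmx W (lift a
  b) c.
  rewrite mxE (bigD1 a) //= (bigD1 (lift a b)) ?neq_lift //= 1?eq_sym ?neq_lift // big1
    ?addr0 //.
  move=> q /andP[qa qb]; case: (unliftP a q) qa qb => [q'|] -> //; last by rewrite eqxx.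
  rewrite (inj_eq lift_inj) => _; case: (unliftP b q') => [q''|] ->; last by rewrite
    eqxx.
  by rewrite y0 mul0r.
have uv0 c : (forall q, c != lift a (lift b q)) -> (u *m v^T) 0 c = 0.
  by move=> cN; rewrite mxE big1 // => q _; rewrite mxE vE (negPf (cN q)) mulr0.
have yb : y 0 (lift a b) = 0.
  have := yE a; rewrite -uv uv0 => [|q]; last by rewrite neq_lift.
  rewrite antisym_diag // mulr0 add0r => /esym/eqP; rewrite mulf_eq0 => /orP[/eqP//|].
  have /matrixP/(_ a (lift a b)) := Winv; rewrite !mxE => ->.
  by rewrite oppr_eq0 (negPf Wab).
have ya : y 0 a = 0.
  have := yE (lift a b); rewrite -uv uv0 => [|q]; last by rewrite (inj_eq lift_inj)
    neq_lift.
  by rewrite yb mul0r addr0 => /esym/eqP; rewrite mulf_eq0 (negPf Wab) orbF => /eqP.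
apply/matrixP=> i j; rewrite ord1 [RHS]mxE.
have := yE (lift a (lift b j)); rewrite ya yb !mul0r addr0 -uv mxE (bigD1 j) //= big1.
  by rewrite mxE vE eqxx mulr1 addr0.
by move=> q qj; rewrite mxE vE !(inj_eq lift_inj) eq_sym (negPf qj) mulr0.
Qed.

Lemma trmx_congr N M (P : 'M[C]_(N, M)) (W : 'M[C]_N) : W^T = - W ->
  (P^T *m W *m P)^T = - (P^T *m W *m P).
Proof. by move=> Wa; rewrite !trmx_mul trmxK Wa mulNmx mulmxN mulmxA. Qed.

(** Induction on the degree. If the power k + 1 vanished, then so would the
    constant of [top_pairing_inv], hence all pairings of the power k; but
    [wedge_at_rank1] recovers from these the value of the power k on a
    nondegenerate subspace, nonzero by induction. *)
Lemma wedge_expn_neq0 k (W : 'M[C]_(k * 2)) : W^T = - W -> W \in unitmx ->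
  @wedge_expn C (k * 2) W k 1%:M != 0.
Proof.
elim: k W => [W _ _|k IH W Wa Wu]; first exact: oner_neq0.
have [c cE] := top_pairing_inv (k := k) Wa Wu.
change (top_pairing (k := k) W W != 0); rewrite cE mulVmx // mxtrace1.
rewrite mulf_neq0 ?pnatr_eq0 //; apply: contraTneq isT => c0.
have Winv := trmx_inv_antisym Wa Wu.
have [a [b Wab]] : exists a b, invmx W a (lift a b) != 0.
  have [/existsP[a /existsP[b ab]]|] := boolP [exists a, exists b, invmx W a b != 0].
    case: (unliftP a b) ab => [b'|] ->; first by move=> ab; exists a, b'.
    by rewrite antisym_diag ?eqxx.
  rewrite negb_exists => /forallP W0.
  have : invmx W = 0.
    apply/matrixP=> p q; rewrite [RHS]mxE.
    by have := W0 p; rewrite negb_exists => /forallP/(_ q); rewrite negbK => /eqP.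
  by move/(congr1 (mulmx W))/eqP; rewrite mulmxV // mulmx0 oner_eq0.
pose v := drop_cols a b.
have Fv : @wedge_expn C (k * 2).+2 W k v != 0.
  rewrite -[v]mulmx1 wedge_expn_mulmx; apply: IH; first exact: trmx_congr.
  exact: drop_cols_unit.
pose b0 : 'rV[C]_(k * 2).+2 := delta_mx 0 a.
pose b1 : 'rV[C]_(k * 2).+2 := delta_mx 0 (lift a b).
have := @wedge_at_rank1 C _ _ b0 b1 _ (delta_mx a 0) (delta_mx (lift a b) 0) v
  (wedge_expn_alt (N := (k * 2).+2) W (k := k)).
rewrite !mul_delta_mx mul_delta_mx_0 ?neq_lift // mxE !eqxx /=.
have bv d : (forall q, d != lift a (lift b q)) -> (delta_mx 0 d : 'rV[C]_(k*2).+2) *m v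
  = 0.
  move=> cN; apply/matrixP=> p q; rewrite mul_drop_cols !mxE [_ == d]eq_sym (negPf (cN
    q)).
  by rewrite andbF.
rewrite !bv => [|q|q]; rewrite ?(inj_eq lift_inj) ?neq_lift //.
move=> /(_ erefl erefl erefl erefl erefl).
have fm : multilinear (wedge_at (bilin (b0^T *m b1)) (@wedge_expn C (2 + k * 2) W k)).
  by apply: wedge_at_multilinear; [exact: bilin_multilinear|exact:
    wedge_expn_multilinear].
rewrite [LHS](top_form_eq0 fm (@wedge_at_alt C (2 + k * 2) 2 (k * 2) _ _)).
  by move/eqP; rewrite eq_sym mulf_eq0 (negPf Fv) invr_eq0 pnatr_eq0.
by have := cE (b0^T *m b1); rewrite c0 mul0r.
Qed.
End Symplectic.

(** * Exterior derivatives with prescribed partial derivatives *)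

Section ExteriorDerivative.
Variable C : numFieldType.

(** The exterior derivative of a form whose partial derivatives at the point
    are the forms h j. *)
Definition ext_diff N k (h : 'I_N -> 'M[C]_(N, k) -> C) : 'M[C]_(N, k.+1) -> C :=
  fun v => \sum_(i < k.+1) (-1) ^+ i * \sum_(j < N) col i v j 0 * h j (col' i v).

Lemma eq_ext_diff N k (h h' : 'I_N -> 'M[C]_(N, k) -> C) :
  (forall j, h j =1 h' j) -> ext_diff h =1 ext_diff h'.
Proof.
move=> hh v; apply: eq_bigr => i _; congr (_ * _); apply: eq_bigr => j _.
by rewrite hh.
Qed.

Lemma ext_diffD N k (h h' : 'I_N -> 'M[C]_(N, k) -> C) v :
  ext_diff (fun j w => h j w + h' j w) v = ext_diff h v + ext_diff h' v.
Proof.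
rewrite -big_split /=; apply: eq_bigr => i _; rewrite -mulrDr; congr (_ * _).
by rewrite -big_split /=; apply: eq_bigr => j _; rewrite mulrDr.
Qed.

Lemma ext_diffZ N k c (h : 'I_N -> 'M[C]_(N, k) -> C) v :
  ext_diff (fun j w => c * h j w) v = c * ext_diff h v.
Proof.
rewrite mulr_sumr; apply: eq_bigr => i _; rewrite mulrCA; congr (_ * _).
by rewrite mulr_sumr; apply: eq_bigr => j _; rewrite mulrCA.
Qed.

Lemma row0E N k (y : 'cV[C]_N) (u : 'M[C]_(N, k)) j :
  (row_mx y u : 'M[C]_(N, 1 + k)) j (0 : 'I_k.+1) = y j 0.
Proof. by have /matrixP/(_ j 0) := col0_row y u; rewrite mxE. Qed.

Lemma row1E N k (y : 'cV[C]_N) (u : 'M[C]_(N, k.+1)) j :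
  (row_mx y u : 'M[C]_(N, 1 + k.+1)) j (1 : 'I_k.+2) = u j 0.
Proof.
have -> : (1 : 'I_k.+2) = lift 0 0 by apply: val_inj.
by have /matrixP/(_ j 0) := colS_row y u 0; rewrite mxE [RHS]mxE.
Qed.

Lemma ext_diff_perm N k (h : 'I_N -> 'M[C]_(N, k) -> C) (v : 'M[C]_(N, k.+1)) :
  (forall j, alternating (h j)) ->
  k`!%:R * ext_diff h v =
  \sum_(s : 'S_k.+1) (-1) ^+ s * \sum_(j < N)
     col_perm s v j 0 * h j (rsubmx (col_perm s v : 'M[C]_(N, 1 + k))).
Proof.
move=> ha; pose Psi (u : 'M[C]_(N, 1 + k)) := \sum_(j < N) u j 0 * h j (rsubmx u).
rewrite [RHS](sum_perm_cofactor Psi) mulr_sumr; apply: eq_bigr => i _.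
rewrite mulrCA; congr (_ * _); rewrite mulr_sumr /Psi.
under [RHS]eq_bigr do rewrite mulr_sumr; rewrite exchange_big; apply: eq_bigr => j _ /=.
under [RHS]eq_bigr do rewrite row_mxKr mulrCA.
rewrite mulrCA -alternating_sum // mulr_sumr; apply: eq_bigr => t _; congr (_ * _).
exact/esym/row0E.
Qed.

Lemma fact_neq0 k : k`!%:R != 0 :> C.
Proof. by rewrite pnatr_eq0 -lt0n fact_gt0. Qed.

(** The contributions of a pair of arguments involve the Christoffel symbols
    only through their antisymmetric part, the torsion. This is why a torsion-
    free connection computes the exterior derivative. *)
Lemma ext_diff_symmetric N k (G : 'I_N -> 'M[C]_N) (f : 'M[C]_(N, k) -> C) v :
  (forall i j, col j (G i) = col i (G j)) -> multilinear f -> alternating f ->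
  ext_diff (fun j => gl_act (G j) f) v = 0.
Proof.
move=> Gs fm fa; apply: (mulfI (fact_neq0 k)); rewrite mulr0 ext_diff_perm; last first.
  by move=> j; apply: gl_act_alt.
pose Gam (u w : 'cV[C]_N) := \sum_j u j 0 *: (G j *m w).
have GamC u w : Gam u w = Gam w u.
  have GamE (x y : 'cV[C]_N) : Gam x y = \sum_i \sum_j (x i 0 * y j 0) *: col j (G i).
    apply: eq_bigr => i _; rewrite {1}(col_sum y) mulmx_sumr scaler_sumr.
    by apply: eq_bigr => j _; rewrite -scalemxAr scalerA -colE.
  rewrite !GamE exchange_big; apply: eq_bigr => i _; apply: eq_bigr => j _.
  by rewrite Gs mulrC.
transitivity (\sum_(s : 'S_k.+1) \sum_(q < k) (-1) ^+ s *
    f (set_col (rsubmx (col_perm s v : 'M[C]_(N, 1 + k))) q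
        (Gam (col 0 (col_perm s v)) (col (lift 0 q) (col_perm s v))))).
  apply: eq_bigr => s _; rewrite -mulr_sumr; congr (_ * _).
  under eq_bigr do rewrite /gl_act mulr_sumr.
  rewrite exchange_big; apply: eq_bigr => q _ /=; rewrite multilinear_sum //.
  apply: eq_bigr => j _; rewrite multilinearZ // [col 0 _ j 0]mxE; congr (_ * f
    (set_col _ _ (_ *m _))).
  apply/matrixP=> a b; rewrite !mxE; congr (v _ (s _)); exact: val_inj.
rewrite exchange_big big1 // => q _ /=; set S := \sum_(s : _) _.
suff : S = - S by move/eqP; rewrite -addr_eq0 -mulr2n -mulr_natl mulf_eq0 pnatr_eq0 =>
  /eqP.
rewrite {1}/S (reindex_inj (mulgI (tperm 0 (lift 0 q)))) -sumrN; apply: eq_bigr => s _.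
rewrite odd_permM odd_tperm neq_lift signr_addb expr1 mulN1r mulNr; congr (- (_ * f _)).
(* Exchanging the two arguments of Gam flips the sign of s and changes no
   other column. *)
rewrite GamC; apply/matrixP=> a b; rewrite !mxE; case: eqP => [_|/eqP bq].
  congr (Gam _ _ a 0); apply/matrixP=> c d; rewrite !mxE !permM ?tpermL ?tpermR //.
rewrite permM tpermD //.
by apply: contra bq => /eqP/(congr1 val) /= [bv]; apply/eqP/val_inj.
Qed.

(** The product of the covector b with the exterior derivative, with the roles
    of the derivation index and of the first wedge factor interchanged. *)
Lemma ext_diff_pairing N k (h : 'I_N -> 'M[C]_(N, k) -> C) (b : 'rV[C]_N) V :
  (forall j, alternating (h j)) ->
  \sum_(j < N) wedge_at (bilin (b^T *m delta_mx 0 j)) (h j) V =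
  2^-1 * \sum_(i < k.+2) (-1) ^+ i * ((b *m col i V) 0 0 * ext_diff h (col' i V)).
Proof.
move=> ha; pose Psi (u : 'M[C]_(N, 2 + k)) :=
  (b *m col 0 u) 0 0 * \sum_(j < N) u j 1 * h j (rsubmx u).
rewrite /wedge_at -mulr_sumr natrM invfM -mulrA; congr (_ * _); rewrite exchange_big /=.
apply: (mulfI (fact_neq0 k)); rewrite mulrA mulfV ?fact_neq0 // mul1r.
transitivity (\sum_(s : 'S_(2 + k)) (-1) ^+ s * Psi (col_perm s V)).
  apply: eq_bigr => s _; rewrite -mulr_sumr; congr (_ * _).
  rewrite /Psi mulr_sumr; apply: eq_bigr => j _; rewrite bilin_rank1 mulrA.
  congr (_ * _ * _).
    by rewrite col_lsubmx; congr ((b *m col _ _) 0 0); apply: val_inj.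
  rewrite mxE (bigD1 j) //= big1 => [|p pj]; first by rewrite !mxE !eqxx mul1r addr0;
    congr (V _ (s _)); apply: val_inj.
  by rewrite !mxE (negPf pj) mul0r.
rewrite (sum_perm_cofactor Psi) mulr_sumr; apply: eq_bigr => i _.
rewrite [RHS]mulrCA; congr (_ * _).
rewrite [RHS]mulrCA ext_diff_perm // mulr_sumr; apply: eq_bigr => t _.
rewrite mulrCA /Psi; congr (_ * (_ * _)).
  by rewrite [col 0 _]col0_row.
apply: eq_bigr => j _; congr (_ * h j _); last exact: rsubmx_row2.
exact: row1E.
Qed.

End ExteriorDerivative.

(** * Closedness of the penultimate power *)

Section Balanced.
Variable C : numFieldType.

(** A form of degree N - 1 vanishes as soon as its product with every covector
    b does: evaluate the product on v completed by one vector, for some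
    nonzero b that kills the columns of v. *)
Lemma ext_diff_eq0P k (h : 'I_k.+2 -> 'M[C]_(k.+2, k) -> C) :
  (forall j, alternating (h j)) ->
  (forall v, ext_diff h v = 0) <->
  (forall (b : 'rV[C]_k.+2) V, \sum_j wedge_at (bilin (b^T *m delta_mx 0 j)) (h j) V =
    0).
Proof.
move=> ha; split=> [h0 b V | h0 v].
  by rewrite ext_diff_pairing // big1 ?mulr0 // => i _; rewrite h0 !mulr0.
have /rowV0Pn[b /sub_kermxP bv b_neq0] : kermx v != 0.
  rewrite kermx_eq0 /row_free; apply/negP => /eqP rv.
  by have := rank_leq_col v; rewrite rv ltnn.
have [c bc] : exists c, b 0 c != 0.
  apply/existsP; apply: contraNT b_neq0; rewrite negb_exists => /forallP b0.
  apply/eqP/matrixP=> i j; rewrite ord1 [RHS]mxE.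
  by have := b0 j; rewrite negbK => /eqP.
pose y : 'cV[C]_k.+2 := (b 0 c)^-1 *: delta_mx c 0.
have by1 : (b *m y) 0 0 = 1.
  by rewrite -scalemxAr mxE -colE mxE mulVf.
have := h0 b (row_mx y v : 'M[C]_(k.+2, 1 + k.+1)).
rewrite ext_diff_pairing // big_ord_recl [X in _ + X]big1 => [|i _].
  rewrite addr0 expr0 mul1r col0_row col'0_row by1 mul1r => /eqP.
  by rewrite mulf_eq0 invr_eq0 pnatr_eq0 /= => /eqP.
have -> : b *m col (lift ord0 i) (row_mx y v : 'M[C]_(k.+2, 1 + k.+1)) = 0.
  by rewrite colS_row -col_mulmx bv col0.
by rewrite mxE mul0r mulr0.
Qed.

(** The differential of the power of degree N - 2 is a divergence of the
    bivector W^-1: the Leibniz rule turns the pairing into the difference of a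
    trace and of two equal terms E_j W^-1 contracted in j. *)
Lemma ext_diff_wedge_expn_eq0P k (W : 'M[C]_(2 + k * 2)) (E : 'I_(2 + k * 2) ->
  'M[C]_(2 + k * 2)) :
  W^T = - W -> W \in unitmx -> (forall j, (E j)^T *m W = W *m E j) ->
  (forall v, ext_diff (fun j => gl_act (E j) (@wedge_expn C (2 + k * 2) W k)) v = 0) <->
  (forall i, \tr (E i) = 2 * \sum_j E j j i).
Proof.
move=> Wa Wu EW; have [c cE] := top_pairing_inv Wa Wu.
have c0 : c != 0.
  have := wedge_expn_neq0 (k := k.+1) Wa Wu.
  by change (top_pairing W W != 0 -> c != 0); rewrite cE mulf_eq0 => /norP[].
have der_pair (b : 'rV[C]_(2 + k * 2)) j : wedge_at (bilin (b^T *m delta_mx 0 j))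
  (gl_act (E j) (@wedge_expn C (2 + k * 2) W k)) 1%:M
    = c * (\tr (E j) * (invmx W *m b^T) j 0 - 2 * (E j *m (invmx W *m b^T)) j 0).
  set phi := b^T *m _.
  have fm : multilinear (wedge_at (bilin phi) (@wedge_expn C (2 + k * 2) W k)).
    by apply: wedge_at_multilinear; [exact: bilin_multilinear|exact:
      wedge_expn_multilinear].
  have := gl_act_wedge_at (E j) (bilin phi) (@wedge_expn C (2 + k * 2) W k) 1%:M.
  rewrite (gl_act_top1 _ fm (@wedge_at_alt C (2 + k * 2) 2 (k * 2) _ _)).
  rewrite -/(top_pairing W phi) cE => dw.
  apply: (addrI (wedge_at (gl_act (E j) (bilin phi)) (@wedge_expn C (2 + k * 2) W k)
    1%:M)).
  rewrite -dw.
  suff -> : wedge_at (gl_act (E j) (bilin phi)) (@wedge_expn C (2 + k * 2) W k) 1%:M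
      = c * (2 * (E j *m (invmx W *m b^T)) j 0).
    rewrite -mulrDr addrC subrK mulrCA; congr (_ * (_ * _)).
    by rewrite /phi mulmxA mxtrace_mulC /mxtrace big_ord1 -rowE mxE.
  transitivity (top_pairing W ((E j)^T *m phi + phi *m E j)).
    by apply: eq_wedge_at => // w; rewrite gl_act_bilin.
  rewrite cE mulmxDr linearD /=; congr (_ * _); rewrite mulr_natl mulr2n.
  have WE : invmx W *m (E j)^T = E j *m invmx W.
    by rewrite -[LHS](mulmxK Wu) -(mulmxA (invmx W)) EW mulKmx.
  have trE : \tr (E j *m invmx W *m phi) = (E j *m (invmx W *m b^T)) j 0.
    by rewrite /phi mulmxA mxtrace_mulC /mxtrace big_ord1 -rowE -!mulmxA mxE.
  congr (_ + _); first by rewrite mulmxA WE.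
  by rewrite mulmxA mxtrace_mulC mulmxA.
have sumE (b : 'rV[C]_(2 + k * 2)) : \sum_j wedge_at (bilin (b^T *m delta_mx 0 j))
  (gl_act (E j) (@wedge_expn C (2 + k * 2) W k)) 1%:M
    = c * \sum_i (\tr (E i) - 2 * \sum_j E j j i) * (invmx W *m b^T) i 0.
  under eq_bigr do rewrite der_pair.
  rewrite -mulr_sumr; congr (_ * _); rewrite sumrB.
  under [X in _ - X]eq_bigr do rewrite mxE mulr_sumr.
  rewrite exchange_big -sumrB; apply: eq_bigr => i _ /=.
  rewrite mulrBl; congr (_ - _); rewrite mulr_sumr mulr_suml.
  by apply: eq_bigr => j _; rewrite mulrA.
have hP := @ext_diff_eq0P (k * 2) (fun j => gl_act (E j) (@wedge_expn C (2 + k * 2) W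
  k))
  (fun j => gl_act_alt (E j) (wedge_expn_alt (N := 2 + k * 2) W (k := k))).
apply: (iff_trans hP); split=> [h0 i|trE b].
  have := h0 (W *m delta_mx i 0)^T 1%:M; rewrite sumE => /eqP.
  rewrite mulf_eq0 (negPf c0) /= trmxK mulKmx // (bigD1 i) //= [X in _ + X]big1 => [|j
    ji].
    by rewrite addr0 mxE !eqxx mulr1 subr_eq0 => /eqP.
  by rewrite mxE (negPf ji) mulr0.
apply: (@top_form_eq0 C (2 + k * 2)
  (fun V => \sum_j wedge_at (bilin (b^T *m delta_mx 0 j)) (gl_act (E j) (@wedge_expn C
    (2 + k * 2) W k)) V)).
- move=> v i a u w; rewrite mulr_sumr -big_split; apply: eq_bigr => j _ /=.
  by apply: wedge_at_multilinear; [exact: bilin_multilinear|apply: gl_act_multilinear;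
    exact: wedge_expn_multilinear].
- move=> s v; rewrite mulr_sumr; apply: eq_bigr => j _.
  exact: (@wedge_at_alt C (2 + k * 2) 2 (k * 2)).
- by rewrite sumE big1 ?mulr0 // => i _; rewrite trE subrr mul0r.
Qed.
End Balanced.

(** * Linear algebra of a quaternionic Hermitian tangent space *)

Section Quaternionic.
Variables (C : numFieldType) (N : nat) (ii : C) (I J g : 'M[C]_N).
Hypothesis ii2 : ii * ii = -1.
Hypothesis I2 : I *m I = - 1%:M.
Hypothesis J2 : J *m J = - 1%:M.
Hypothesis IJ : I *m J = - (J *m I).
Hypothesis gT : g^T = g.
Hypothesis gu : g \in unitmx.
Hypothesis gI : I^T *m g = - (g *m I).
Hypothesis gJ : J^T *m g = - (g *m J).

Definition p10 : 'M[C]_N := 2^-1 *: (1%:M - ii *: I).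
Definition p01 : 'M[C]_N := 2^-1 *: (1%:M + ii *: I).
(** The matrix of the form Omega, which equals g (J + i K), written so that
    its type (2, 0) is apparent. *)
Definition Theta : 'M[C]_N := 2 *: (g *m J *m p10).

Lemma trmxZ p q a (A : 'M[C]_(p, q)) : (a *: A)^T = a *: A^T.
Proof. exact: linearZ. Qed.

Lemma half_double p q (A : 'M[C]_(p, q)) : 2^-1 *: (A + A) = A.
Proof. by apply/matrixP=> i j; rewrite !mxE; field. Qed.

Lemma p10D01 : p10 + p01 = 1%:M.
Proof. by rewrite -scalerDr addrACA addNr addr0 half_double. Qed.

Lemma I_p10 : I *m p10 = ii *: p10.
Proof.
rewrite /p10 -scalemxAr scalerA mulrC -scalerA; congr (_ *: _).
by rewrite mulmxBr -scalemxAr I2 mulmx1 scalerBr scalerA ii2 scalerN opprK scaleN1r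
  opprK addrC.
Qed.

Lemma comm_p10 (A : 'M[C]_N) : A *m I = I *m A -> A *m p10 = p10 *m A.
Proof.
move=> AI; rewrite /p10 -scalemxAr -scalemxAl mulmxBr mulmxBl -scalemxAr -scalemxAl.
by rewrite AI mulmx1 mul1mx.
Qed.

Lemma p10_idem : p10 *m p10 = p10.
Proof.
rewrite {1}/p10 -scalemxAl mulmxBl mul1mx -scalemxAl I_p10 scalerA ii2 scaleN1r opprK.
exact: half_double.
Qed.

Lemma p01E : p01 = 1%:M - p10.
Proof. by rewrite -p10D01 addrC addKr. Qed.

Lemma p10_01 : p10 *m p01 = 0.
Proof. by rewrite p01E mulmxBr mulmx1 p10_idem subrr. Qed.

Lemma p01_10 : p01 *m p10 = 0.
Proof. by rewrite p01E mulmxBl mul1mx p10_idem subrr. Qed.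

Lemma J_p10 : J *m p10 = p01 *m J.
Proof.
rewrite /p10 /p01 -scalemxAr -scalemxAl mulmxBr mulmxDl -scalemxAr -scalemxAl IJ.
by rewrite mulmx1 mul1mx scalerN.
Qed.

Lemma J_p01 : J *m p01 = p10 *m J.
Proof. by rewrite p01E mulmxBr J_p10 p01E mulmxBl mulmx1 mul1mx opprB addrC subrK. Qed.

Lemma p10T_g : p10^T *m g = g *m p01.
Proof.
have -> : p10^T = 2^-1 *: (1%:M - ii *: I^T).
  by apply/matrixP=> a b; rewrite !mxE eq_sym.
rewrite /p01 -scalemxAl -scalemxAr.
by rewrite mulmxBl mulmxDr mul1mx mulmx1 -scalemxAl gI -scalemxAr scalerN opprK.
Qed.

Lemma p10T_Theta : p10^T *m Theta = Theta.
Proof.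
rewrite /Theta -scalemxAr !mulmxA p10T_g -(mulmxA g p01 J) -J_p10.
by rewrite -!mulmxA p10_idem.
Qed.

Lemma Theta_p10 : Theta *m p10 = Theta.
Proof. by rewrite /Theta -scalemxAl -!mulmxA p10_idem. Qed.

Lemma Theta_congr : p10^T *m Theta *m p10 = Theta.
Proof. by rewrite p10T_Theta Theta_p10. Qed.

Lemma Theta_antisym : Theta^T = - Theta.
Proof.
rewrite /Theta linearZ /= !trmx_mul gT gJ mulmxN -scalerN; congr (_ *: - _).
by rewrite mulmxA p10T_g -!mulmxA J_p10.
Qed.

Lemma eq_opp0 (c : C) : c = - c -> c = 0.
Proof. by move/eqP; rewrite -addr_eq0 -mulr2n -mulr_natl mulf_eq0 pnatr_eq0 => /eqP.
  Qed.

(** Conjugation by J fixes A and changes the sign of I. *)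
Lemma tr_commI (A : 'M[C]_N) : A *m J = J *m A -> \tr (A *m I) = 0.
Proof.
move=> AJ; have JI : J *m I = - (I *m J) by rewrite IJ opprK.
have : \tr (A *m I *m J *m J) = 0.
  apply: eq_opp0; rewrite {1}mxtrace_mulC !mulmxA -AJ -(mulmxA A J I) JI.
  by rewrite mulmxN mulNmx linearN /= mulmxA.
by rewrite -(mulmxA _ J J) J2 mulmxN mulmx1 linearN /= => /eqP; rewrite oppr_eq0 =>
  /eqP.
Qed.

Lemma tr_p10 (A : 'M[C]_N) : A *m J = J *m A -> \tr (p10 *m A) = 2^-1 * \tr A.
Proof.
move=> AJ; rewrite mxtrace_mulC /p10 -scalemxAr linearZ /=; congr (_ * _).
by rewrite mulmxBr mulmx1 -scalemxAr linearB linearZ /= tr_commI // mulr0 subr0.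
Qed.

(** J exchanges the two eigenspaces of I, which are complementary. *)
Lemma rank_p10 n : N = (4 * n)%N -> \rank p10 = (n * 2)%N.
Proof.
move=> N4; have r01 : \rank p10 = \rank p01.
  have le10 : (\rank p10 <= \rank p01)%N.
    have -> : p10 = - (J *m p01 *m J).
      by rewrite J_p01 -mulmxA J2 mulmxN mulmx1 opprK.
    by rewrite mxrank_opp; apply: leq_trans (mxrankM_maxl _ _) (mxrankM_maxr _ _).
  have le01 : (\rank p01 <= \rank p10)%N.
    have -> : p01 = - (J *m p10 *m J).
      by rewrite J_p10 -mulmxA J2 mulmxN mulmx1 opprK.
    by rewrite mxrank_opp; apply: leq_trans (mxrankM_maxl _ _) (mxrankM_maxr _ _).
  by apply/eqP; rewrite eqn_leq le10.
have : (\rank p10 + \rank p01 = N)%N.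
  apply/eqP; rewrite eqn_leq mulmx0_rank_max ?p10_01 //=.
  by rewrite -{1}(mxrank1 C N) -p10D01 mxrank_add.
rewrite -r01 addnn -muln2 => rN; apply/eqP; rewrite -(eqn_pmul2r (isT : 0 < 2)%N) rN.
by rewrite N4 mulnC -mulnA.
Qed.

(** A basis B of T^(1,0) together with the coordinates L along T^(0,1). *)
Lemma p10_factor n : N = (4 * n)%N ->
  exists (B : 'M[C]_(N, n * 2)) (L : 'M[C]_(n * 2, N)), p10 = B *m L /\ L *m B = 1%:M.
Proof.
move=> /rank_p10 r.
have [B [L [pBL Bf Lf]]] : exists (B : 'M[C]_(N, \rank p10)) (L : 'M[C]_(\rank p10, N)),
    [/\ p10 = B *m L, row_full B & row_free L].
  exists (col_base p10), (row_base p10).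
  by rewrite mulmx_base col_base_full row_base_free.
rewrite r in B L pBL Bf Lf *; exists B, L; split=> //.
apply: (row_free_inj Lf); apply: (row_full_inj Bf); rewrite mul1mx -pBL.
by rewrite !mulmxA -pBL -mulmxA -pBL p10_idem.
Qed.

Section TopForm.
Variable n : nat.
Hypothesis N4 : N = (4 * n)%N.
Local Notation Om := (@wedge_expn C N Theta n).

Lemma Om_p10 v : Om (p10 *m v) = Om v.
Proof. by rewrite wedge_expn_mulmx Theta_congr. Qed.

Lemma Om_p01_col v i : p10 *m col i v = 0 -> Om v = 0.
Proof.
move=> vi; rewrite -Om_p10; apply: (multilinear_col0 (wedge_expn_multilinear (k := n)
  Theta) (i := i)).
by rewrite col_mulmx.
Qed.

(** In the coordinates of T^(1,0) the form is of top degree, so E acts by its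
    trace there, which is half of the full trace. *)
Lemma gl_act_Om E v : E *m I = I *m E -> E *m J = J *m E ->
  gl_act E Om v = 2^-1 * \tr E * Om v.
Proof.
move=> EI EJ; have [B [L [pBL LB]]] := p10_factor N4.
pose H (w : 'M[C]_(n * 2)) := Om (B *m w).
have Hm : multilinear H.
  by move=> w i a u z; rewrite /H !mulmx_set_col mulmxDr -scalemxAr; apply:
    wedge_expn_multilinear.
have Ha : alternating H.
  move=> s w; rewrite /H -(wedge_expn_alt (k := n) Theta) col_permE mulmxA.
  by rewrite -col_permE.
have -> : Om v = H (L *m v) by rewrite /H mulmxA -pBL Om_p10.
rewrite -(tr_p10 EJ) pBL -mulmxA mxtrace_mulC -gl_act_top // /gl_act.
apply: eq_bigr => i _; rewrite -Om_p10 mulmx_set_col /H mulmx_set_col pBL !mulmxA.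
congr (Om (set_col _ _ _)).
rewrite col_mulmx !mulmxA -pBL -(mulmxA _ B L) -pBL -(mulmxA p10 E p10).
by rewrite (comm_p10 EI) mulmxA p10_idem.
Qed.

(** Nonvanishing of the top power holds because Omega is nondegenerate on
    T^(1,0). *)
Lemma Om_basis : exists B : 'M[C]_(N, n * 2), p10 *m B = B /\ Om B != 0.
Proof.
have [B [L [pBL LB]]] := p10_factor N4; exists B.
have pB : p10 *m B = B by rewrite pBL -mulmxA LB mulmx1.
split=> //; rewrite -[B]mulmx1 wedge_expn_mulmx; apply: wedge_expn_neq0.
  exact: trmx_congr Theta_antisym.
rewrite -row_free_unit; apply: inj_row_free => u; rewrite !mulmxA => uB.
have ThB : Theta *m B = 2 *: (g *m J *m B).
  by rewrite /Theta -scalemxAl -!mulmxA pB.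
rewrite -mulmxA ThB -scalemxAr in uB.
have {}uB : u *m B^T *m g *m J *m B = 0.
  move/eqP: uB; rewrite scaler_eq0 pnatr_eq0 /= => /eqP; by rewrite !mulmxA.
have uBp : u *m B^T *m g *m J *m p10 = 0 by rewrite pBL mulmxA uB mul0mx.
have uBq : u *m B^T *m g *m J *m p01 = 0.
  rewrite -pB trmx_mul -!mulmxA J_p01 !mulmxA -(mulmxA _ _ g) p10T_g !mulmxA.
  by rewrite -(mulmxA _ p01 p10) p01_10 mulmx0 mul0mx.
have : u *m B^T *m g *m J = 0 by rewrite -[LHS]mulmx1 -p10D01 mulmxDr uBp uBq addr0.
move/(congr1 (fun A => A *m J *m invmx g)).
rewrite !mul0mx -(mulmxA _ J J) J2 mulmxN mulmx1 mulNmx mulmxK //.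
move/(congr1 (fun A => - A *m L^T)).
by rewrite opprK oppr0 mul0mx -mulmxA -trmx_mul LB trmx1 mulmx1.
Qed.

End TopForm.

Section Traces.
Variable E : 'I_N -> 'M[C]_N.
Hypothesis Eg : forall l, (E l)^T *m g = g *m E l.
Hypothesis EI : forall l, E l *m I = I *m E l.
Hypothesis EJ : forall l, E l *m J = J *m E l.

Lemma E_Theta l : (E l)^T *m Theta = Theta *m E l.
Proof.
rewrite /Theta -scalemxAr -scalemxAl !mulmxA Eg -!mulmxA (mulmxA (E l)) EJ.
by rewrite -!mulmxA (comm_p10 (EI l)).
Qed.

Definition tr_row : 'rV[C]_N := \row_i \tr (E i).
(** The components of the 1-form u |-> tr (w |-> E_w u). *)
Definition div_row : 'rV[C]_N := \row_i \sum_j E j j i.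

Definition lincomb_mx (u : 'cV[C]_N) : 'M[C]_N := \sum_l u l 0 *: E l.
(** The endomorphism w |-> E_w x. *)
Definition act_at (x : 'cV[C]_N) : 'M[C]_N := \matrix_(a, j) (E j *m x) a 0.

Lemma lincomb_mxE u x : lincomb_mx u *m x = act_at x *m u.
Proof.
rewrite mulmx_suml; apply/matrixP=> a b; rewrite (ord1 b) summxE mxE.
by apply: eq_bigr => l _; rewrite -scalemxAl mxE mulrC [in RHS]mxE.
Qed.

Lemma tr_lincomb_mx u : \tr (lincomb_mx u) = (tr_row *m u) 0 0.
Proof.
rewrite /lincomb_mx [LHS]linear_sum mxE; apply: eq_bigr => l _ /=.
by rewrite linearZ /= mxE mulrC.
Qed.

Lemma tr_act_at u : \tr (act_at u) = (div_row *m u) 0 0.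
Proof.
rewrite mxE /mxtrace; under eq_bigr do rewrite mxE mxE.
rewrite exchange_big; apply: eq_bigr => l _ /=; rewrite mxE mulr_suml.
by [].
Qed.

Lemma Theta_swap (u x z : 'cV[C]_N) :
  (x^T *m Theta *m (lincomb_mx u *m z)) 0 0 = - (z^T *m Theta *m (lincomb_mx u *m x)) 0
    0.
Proof.
have uT : (Theta *m lincomb_mx u)^T = - (Theta *m lincomb_mx u).
  rewrite trmx_mul Theta_antisym mulmxN; congr (- _).
  have -> : (lincomb_mx u)^T = \sum_l u l 0 *: (E l)^T.
    by rewrite [LHS]linear_sum; apply: eq_bigr => l _; exact: trmxZ.
  rewrite mulmx_sumr mulmx_suml; apply: eq_bigr => l _.
  by rewrite -(scalemxAl (u l 0)) -(scalemxAr (u l 0)) E_Theta.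
transitivity ((x^T *m Theta *m (lincomb_mx u *m z))^T 0 0); first by rewrite [RHS]mxE.
rewrite !mulmxA -(mulmxA x^T) !trmx_mul trmxK -trmx_mul uT mulNmx mulmxN !mulmxA.
by rewrite [LHS]mxE.
Qed.

Lemma ext_diff_Theta (x y z : 'cV[C]_N) (v : 'M[C]_(N, 3)) :
  col 0 v = x -> col 1 v = y -> col ord_max v = z ->
  ext_diff (fun l => gl_act (E l) (bilin Theta)) v =
  2 * ((y^T *m Theta *m (lincomb_mx x *m z)) 0 0
       - (x^T *m Theta *m (lincomb_mx y *m z)) 0 0
       + (x^T *m Theta *m (lincomb_mx z *m y)) 0 0).
Proof.
move=> vx vy vz.
have term (u : 'cV[C]_N) (w : 'M[C]_(N, 2)) :
    \sum_j u j 0 * gl_act (E j) (bilin Theta) w =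
    2 * ((col 0 w)^T *m Theta *m (lincomb_mx u *m col 1 w)) 0 0.
  rewrite mulmx_suml mulmx_sumr summxE mulr_sumr; apply: eq_bigr => j _.
  rewrite gl_act_bilin E_Theta /bilin mulmxDr mulmxDl [in LHS]mxE -(scalemxAl (u j 0))
    -(scalemxAr (u j 0)).
  by rewrite !mulmxA [(_ *: _ : 'M[C]_1) 0 0]mxE; ring.
rewrite /ext_diff !big_ord_recl big_ord0 !term addr0.
have c i j : col j (col' i v) = col (lift i j) v.
  by apply/matrixP=> p q; rewrite !mxE.
have i1 : lift ord0 ord0 = 1 :> 'I_3 by apply: val_inj.
have i2 : lift ord0 (lift ord0 ord0) = ord_max :> 'I_3 by apply: val_inj.
have l01 : lift (0 : 'I_3) (1 : 'I_2) = ord_max by apply: val_inj.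
have l10 : lift (1 : 'I_3) (0 : 'I_2) = 0 by apply: val_inj.
have l11 : lift (1 : 'I_3) (1 : 'I_2) = ord_max by apply: val_inj.
have l20 : lift (ord_max : 'I_3) (0 : 'I_2) = 0 by apply: val_inj.
have l21 : lift (ord_max : 'I_3) (1 : 'I_2) = 1 by apply: val_inj.
rewrite i2 i1 !c i1 l01 l10 l11 l20 l21 vx vy vz /= expr0 expr1 sqrrN expr1n.
by ring.
Qed.

(** Polarised on T^(1,0), the condition reads Theta E_x + A^T - A = 0 with A =
    Theta (w |-> E_w x). Applying the inverse of Theta and taking traces, the
    two terms in A add up because this inverse is antisymmetric. *)
Lemma hkt_trace :
  (forall v : 'M[C]_(N, 3), ext_diff (fun l => gl_act (E l) (bilin Theta)) (p10 *m v) =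
    0) ->
  tr_row *m p10 = 4 *: (div_row *m p10).
Proof.
move=> hkt.
have d0 (x y z : 'cV[C]_N) : p10 *m x = x -> p10 *m y = y -> p10 *m z = z ->
    (y^T *m Theta *m (lincomb_mx x *m z)) 0 0 + (z^T *m Theta *m (act_at x *m y)) 0 0
    - (y^T *m Theta *m (act_at x *m z)) 0 0 = 0.
  move=> px py pz.
  pose v : 'M[C]_(N, 3) := \matrix_(a, q)
    (if q == 0 then x a 0 else if q == 1 then y a 0 else z a 0).
  have v0 : col 0 v = x by apply/matrixP=> a b; rewrite !mxE (ord1 b).
  have v1 : col 1 v = y by apply/matrixP=> a b; rewrite !mxE (ord1 b).
  have v2 : col ord_max v = z by apply/matrixP=> a b; rewrite !mxE (ord1 b).
  have := hkt v; rewrite (ext_diff_Theta (x := x) (y := y) (z := z)); first last.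
  - by rewrite col_mulmx v2.
  - by rewrite col_mulmx v1.
  - by rewrite col_mulmx v0.
  rewrite (Theta_swap y) (Theta_swap z) !lincomb_mxE opprK => /eqP.
  by rewrite mulf_eq0 pnatr_eq0 /= => /eqP.
pose Zi := 2^-1 *: - (J *m invmx g).
have ZTheta : Zi *m Theta = p10.
  rewrite /Zi /Theta -scalemxAl -scalemxAr scalerA mulVf ?pnatr_eq0 // scale1r.
  by rewrite mulNmx !mulmxA mulmxKV // J2 !mulNmx mul1mx opprK.
have ZiT : Zi^T = - Zi.
  rewrite /Zi trmxZ -scalerN opprK; congr (_ *: _).
  rewrite linearN /= trmx_mul trmx_inv gT -[LHS](mulmxK gu) mulNmx -mulmxA gJ.
  by rewrite mulmxN opprK mulmxA mulVmx // mul1mx.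
(* The contracted cyclic identity, with the first argument x left free. *)
have main x : p10 *m x = x -> \tr (lincomb_mx x) = 4 * \tr (act_at x).
  move=> px; pose A := Theta *m act_at x *m p10.
  have mxid : Theta *m lincomb_mx x *m p10 + A^T - A = 0.
    apply/matrixP=> a b; rewrite [RHS]mxE.
    have pd c : p10 *m (p10 *m delta_mx c 0) = p10 *m (delta_mx c 0 : 'cV[C]_N).
      by rewrite mulmxA p10_idem.
    rewrite -(d0 x (p10 *m delta_mx a 0) (p10 *m delta_mx b 0) px (pd a) (pd b)).
    have ent (S : 'M[C]_N) c d :
       ((p10 *m (delta_mx c 0 : 'cV[C]_N))^T *m Theta *m (S *m (p10 *m (delta_mx d 0 :
         'cV[C]_N)))) 0 0
       = (Theta *m S *m p10) c d.
      rewrite trmx_mul trmx_delta -(mulmxA _ p10^T) p10T_Theta !mulmxA.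
      by rewrite -colE [LHS]mxE -!mulmxA -rowE [LHS]mxE.
    have entry (S T : 'M[C]_N) : (S + A^T - T) a b = S a b + A b a - T a b.
      by rewrite !mxE.
    by rewrite !ent entry.
  have trA : \tr (Zi *m A^T) = - \tr (Zi *m A).
    rewrite -mxtrace_tr trmx_mul trmxK ZiT mulmxN linearN /=; congr (- _).
    exact: mxtrace_mulC.
  have ZA : \tr (Zi *m A) = \tr (act_at x).
    rewrite /A !mulmxA ZTheta mxtrace_mulC mulmxA p10_idem; congr (\tr _).
    apply/matrixP=> a j; rewrite mxE [RHS]mxE.
    have <- : p10 *m (E j *m x) = E j *m x by rewrite mulmxA -(comm_p10 (EI j)) -mulmxA
      px.
    by rewrite [RHS]mxE; apply: eq_bigr => b _; rewrite [act_at x b j]mxE.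
  have ZE : \tr (Zi *m (Theta *m lincomb_mx x *m p10)) = 2^-1 * \tr (lincomb_mx x).
    rewrite !mulmxA ZTheta mxtrace_mulC mulmxA p10_idem tr_p10 //.
    rewrite mulmx_suml mulmx_sumr; apply: eq_bigr => l _.
    by rewrite -scalemxAl -scalemxAr EJ.
  have := congr1 (fun B => \tr (Zi *m B)) mxid.
  rewrite /= mulmx0 linear0 mulmxBr mulmxDr linearB linearD /= trA ZA ZE => /eqP.
  rewrite -addrA -opprD subr_eq0 => /eqP/(congr1 (fun c => 2 * c)).
  by rewrite mulrA mulfV ?pnatr_eq0 // mul1r => ->; ring.
apply/rowP=> b.
have pb : p10 *m col b p10 = col b p10 by rewrite -col_mulmx p10_idem.
have := main _ pb; rewrite tr_lincomb_mx tr_act_at -!col_mulmx.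
by rewrite [X in X = _ -> _]mxE [X in _ = _ * X -> _]mxE => ->; rewrite [RHS]mxE.
Qed.

Section Delbar.
Variable n : nat.
Hypothesis N4 : N = (4 * n)%N.
Local Notation Om := (@wedge_expn C N Theta n).

Definition type_mix k (S : {set 'I_k}) (v : 'M[C]_(N, k)) : 'M[C]_(N, k) :=
  \matrix_(i, j) (if j \in S then (p10 *m v) i j else (p01 *m v) i j).

Lemma col_type_mix k (S : {set 'I_k}) (v : 'M[C]_(N, k)) j :
  col j (type_mix S v) = (if j \in S then p10 else p01) *m col j v.
Proof.
by apply/matrixP=> a b; rewrite 2![LHS]mxE; case: ifP => _; rewrite -col_mulmx [RHS]mxE.
Qed.

Lemma missing_index k (S : {set 'I_k.+1}) : #|S| = k -> exists j, j \notin S.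
Proof.
move=> Sk; have : S != [set: 'I_k.+1].
  by apply/eqP => S1; move: Sk; rewrite S1 cardsT card_ord => /esym/n_Sn.
by rewrite -finset.subTset => /subsetPn[j _ jS]; exists j.
Qed.

Lemma ext_diff_Om v : ext_diff (fun l => gl_act (E l) Om) v =
  \sum_(i < (n * 2).+1) (-1) ^+ i * (2^-1 * (tr_row *m col i v) 0 0 * Om (col' i v)).
Proof.
apply: eq_bigr => i _; congr (_ * _).
rewrite mxE mulr_sumr mulr_suml; apply: eq_bigr => l _.
by rewrite gl_act_Om // [tr_row _ _]mxE; ring.
Qed.

(** On n * 2 vectors of T^(1,0) and one of T^(0,1), only the term that
    differentiates along the latter survives, for Omega^n kills T^(0,1).
    Evaluated on a basis of T^(1,0) completed by a vector of T^(0,1), it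
    isolates the trace. *)
Lemma delbar_trace :
  (forall v, \sum_(S : {set 'I_(n * 2).+1} | #|S| == (n * 2)%N)
     ext_diff (fun l => gl_act (E l) Om) (type_mix S v) = 0) <-> tr_row *m p01 = 0.
Proof.
split=> [h0|t0 v]; last first.
  apply: big1 => S /eqP Sk; rewrite ext_diff_Om; apply: big1 => i _.
  have [j jS] := missing_index Sk.
  have [iS|iS] := boolP (i \in S); last first.
    by rewrite col_type_mix (negPf iS) mulmxA t0 mul0mx mxE !(mulr0, mul0r).
  have : j != i by apply: contraNneq jS => ->.
  rewrite eq_sym => /unlift_some[j' jj' _].
  rewrite (Om_p01_col (i := j')) ?mulr0 //.
  have -> : col j' (col' i (type_mix S v)) = col j (type_mix S v).
    by apply/matrixP=> a b; rewrite jj' !mxE.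
  by rewrite col_type_mix (negPf jS) mulmxA p10_01 mul0mx.
have [B [pB OmB]] := Om_basis N4.
apply/rowP=> b; rewrite [RHS]mxE.
(* A basis of T^(1,0) preceded by a vector of T^(0,1): only the set S that
   omits the first index contributes. *)
pose v : 'M[C]_(N, (n * 2).+1) := row_mx (col b p01) B : 'M[C]_(N, 1 + n * 2).
have v0 : col 0 v = col b p01 by exact: col0_row.
have vS i : col (lift 0 i) v = col i B by exact: colS_row.
have v' : col' 0 v = B by exact: col'0_row.
have pv0 : p10 *m col b p01 = 0 by rewrite -col_mulmx p10_01 col0.
have qv0 : p01 *m col b p01 = col b p01.
  by rewrite -col_mulmx {1}p01E mulmxBl mul1mx p10_01 subr0.
have qB : p01 *m B = 0 by rewrite -pB mulmxA p01_10 mul0mx.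
have mixv : type_mix (~: [set 0]) v = v.
  apply/matrixP=> a j.
  have /matrixP/(_ a 0) := col_type_mix (~: [set 0]) v j; rewrite [LHS]mxE => ->.
  case: (unliftP 0 j) => [i|] ->.
    by rewrite !inE eq_sym neq_lift /= vS -col_mulmx pB -vS mxE.
  by rewrite !inE eqxx /= v0 qv0 -v0 mxE.
have := h0 v; rewrite (bigD1 (~: [set 0])) /=; last by rewrite cardsC1 card_ord.
rewrite [X in _ + X]big1 => [|S /andP[/eqP Sk SN]].
  rewrite addr0 mixv ext_diff_Om big_ord_recl [X in _ + X]big1 => [|i _].
    rewrite addr0 expr0 mul1r v0 v' -col_mulmx => /eqP.
    rewrite !mulf_eq0 (negPf OmB) orbF invr_eq0 pnatr_eq0 /= => /eqP <-.
    by rewrite [RHS]mxE.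
  have [i0 i0E] : exists i0, lift (lift ord0 i) i0 = 0.
    by have := neq_lift ord0 i; rewrite eq_sym => /unlift_some[i0 i0E _]; exists i0.
  rewrite (Om_p01_col (i := i0)) ?mulr0 //.
  have -> : col i0 (col' (lift ord0 i) v) = col 0 v.
    by apply/matrixP=> a c; rewrite -i0E !mxE.
  by rewrite v0.
have S0 : 0 \in S.
  apply: contraNT SN => S0; rewrite eqEcard cardsC1 card_ord Sk leqnn andbT.
  by apply/fintype.subsetP=> i iS; rewrite !inE; apply: contraNneq S0 => <-.
have [j jS] := missing_index Sk.
have w0 : col 0 (type_mix S v) = 0 by rewrite col_type_mix S0 v0 pv0.
have wj : col j (type_mix S v) = 0.
  rewrite col_type_mix (negPf jS).
  case: (unliftP 0 j) jS => [i|] -> jS; last by rewrite S0 in jS.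
  by rewrite vS -col_mulmx qB col0.
rewrite ext_diff_Om; apply: big1 => i _.
have [->|] := eqVneq i 0; first by rewrite w0 mulmx0 mxE !(mulr0, mul0r).
move=> /unlift_some[i0 i0E _].
rewrite (Om_p01_col (i := i0)) ?mulr0 //.
have -> : col i0 (col' i (type_mix S v)) = col 0 (type_mix S v).
  by apply/matrixP=> a c; rewrite i0E !mxE.
by rewrite w0 mulmx0.
Qed.

End Delbar.
End Traces.
End Quaternionic.

(** * The Obata connection at a point *)

Section ObataFormula.
Variables (C : numFieldType) (N : nat).
Local Notation V := 'cV[C]_N.
Variables (i j : V -> V) (p q : V -> V -> V).
Hypothesis iD : {morph i : x y / x + y}.
Hypothesis iN : {morph i : x / - x}.
Hypothesis jD : {morph j : x y / x + y}.
Hypothesis jN : {morph j : x / - x}.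
Hypothesis pNl : forall x z, p (- x) z = - p x z.
Hypothesis pNr : forall x z, p x (- z) = - p x z.
Hypothesis qNl : forall x z, q (- x) z = - q x z.
Hypothesis qNr : forall x z, q x (- z) = - q x z.
Hypothesis ii : forall v, i (i v) = - v.
Hypothesis jj : forall v, j (j v) = - v.
Hypothesis ji : forall v, j (i v) = - i (j v).
Hypothesis pi : forall x v, p x (i v) = - i (p x v).
Hypothesis qj : forall x v, q x (j v) = - j (q x v).
Hypothesis qi : forall x v, q x (i v) = - p x (j v) - i (q x v) - j (p x v).

(** The Nijenhuis tensor of an almost complex structure a on constant vector
    fields, d being the derivative of a. *)
Definition nijenhuis_of (a : V -> V) (d : V -> V -> V) (x y : V) : V :=
  d (a x) y - d (a y) x - a (d x y) + a (d y x).
Definition kk v := i (j v).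
Definition kd x v := p x (j v) + i (q x v).
(** The formula D_x y = ([x, y] + I [I x, y] - J [x, J y] + K [I x, J y]) / 2
    for constant vector fields x and y, doubled; p and q are the derivatives
    of I and J. *)
Definition twice_obata x y : V :=
  - i (p y x) - j (q x y) + kk (q (i x) y) - kk (p (j y) x).

Lemma addcE (x y : V) a : (x + y) a 0 = x a 0 + y a 0.
Proof. by rewrite mxE. Qed.
Lemma oppcE (x : V) a : (- x) a 0 = - x a 0.
Proof. by rewrite mxE. Qed.

Let E := (iD, iN, jD, jN, ii, jj, ji, pi, qj, qi, pNl, pNr, qNl, qNr).

(** Applying J exchanges the four terms of the formula in pairs, up to the
    derivative of J. *)
Lemma twice_obata_J x y : q x y + q x y + twice_obata x (j y) = j (twice_obata x y).
Proof.
rewrite /twice_obata /kk !E; apply/matrixP=> a b; rewrite ord1.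
by rewrite !(addcE, oppcE); ring.
Qed.

(** The failure to preserve I is a combination of values of the Nijenhuis
    tensor of I. *)
Lemma twice_obata_I x y : p x y + p x y + twice_obata x (i y) - i (twice_obata x y)
  = - (nijenhuis_of i p x (i y) + j (nijenhuis_of i p x (kk y))).
Proof.
rewrite /twice_obata /nijenhuis_of /kk !E; apply/matrixP=> a b; rewrite ord1.
by rewrite !(addcE, oppcE); ring.
Qed.

(** The torsion is a combination of values of the three Nijenhuis tensors. *)
Lemma twice_obata_sym x y : twice_obata x y - twice_obata y x
  = - (i (nijenhuis_of kk kd x (i y)) + kk (nijenhuis_of i p (j x) (i y)) + i
    (nijenhuis_of j q (kk x) (j y))).
Proof.
rewrite /twice_obata /nijenhuis_of /kd /kk !E; apply/matrixP=> a b; rewrite ord1.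
by rewrite !(addcE, oppcE); ring.
Qed.
End ObataFormula.

Section ObataMatrices.
Variables (C : numFieldType) (N : nat) (I J : 'M[C]_N) (P Q : 'I_N -> 'M[C]_N).
Hypothesis I2 : I *m I = - 1%:M.
Hypothesis J2 : J *m J = - 1%:M.
Hypothesis IJ : I *m J = - (J *m I).
Hypothesis PI : forall l, P l *m I = - (I *m P l).
Hypothesis QJ : forall l, Q l *m J = - (J *m Q l).
Hypothesis PQ : forall l, P l *m J + I *m Q l = - (Q l *m I + J *m P l).

Definition nijenhuis_mx (A : 'M[C]_N) (D : 'I_N -> 'M[C]_N) (x y : 'cV[C]_N) : 'cV[C]_N
  :=
  nijenhuis_of (mulmx A) (fun x y => lincomb_mx D x *m y) x y.

Lemma lincomb_mxN (D : 'I_N -> 'M[C]_N) x : lincomb_mx D (- x) = - lincomb_mx D x.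
Proof. by rewrite -sumrN; apply: eq_bigr => l _; rewrite mxE scaleNr. Qed.

Lemma lincomb_mx_delta (D : 'I_N -> 'M[C]_N) l : lincomb_mx D (delta_mx l 0) = D l.
Proof.
rewrite /lincomb_mx (bigD1 l) //= big1 ?addr0 => [|k kl].
  by rewrite mxE !eqxx scale1r.
by rewrite mxE (negPf kl) scale0r.
Qed.

Lemma mulmx_ext (A B : 'M[C]_N) : (forall v : 'cV[C]_N, A *m v = B *m v) -> A = B.
Proof.
by move=> AB; apply/matrixP=> a b; have /matrixP/(_ a 0) := AB (delta_mx b 0);
  rewrite -!colE !mxE.
Qed.

Lemma obata_exists :
  (forall x y, nijenhuis_mx I P x y = 0) -> (forall x y, nijenhuis_mx J Q x y = 0) ->
  (forall x y, nijenhuis_mx (I *m J) (fun l => P l *m J + I *m Q l) x y = 0) ->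
  exists G : 'I_N -> 'M[C]_N,
    [/\ forall k l, col k (G l) = col l (G k),
        forall l, P l = I *m G l - G l *m I & forall l, Q l = J *m G l - G l *m J].
Proof.
move=> NI NJ NK.
pose i := (mulmx I : 'cV[C]_N -> 'cV[C]_N); pose j := (mulmx J : 'cV[C]_N -> 'cV[C]_N).
pose p (x y : 'cV[C]_N) := lincomb_mx P x *m y; pose q (x y : 'cV[C]_N) := lincomb_mx Q
  x *m y.
have iD : {morph i : x y / x + y} by move=> x y; rewrite /i mulmxDr.
have iN : {morph i : x / - x} by move=> x; rewrite /i mulmxN.
have jD : {morph j : x y / x + y} by move=> x y; rewrite /j mulmxDr.
have jN : {morph j : x / - x} by move=> x; rewrite /j mulmxN.
have pNl x z : p (- x) z = - p x z by rewrite /p lincomb_mxN mulNmx.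
have pNr x z : p x (- z) = - p x z by rewrite /p mulmxN.
have qNl x z : q (- x) z = - q x z by rewrite /q lincomb_mxN mulNmx.
have qNr x z : q x (- z) = - q x z by rewrite /q mulmxN.
have ii v : i (i v) = - v by rewrite /i mulmxA I2 mulNmx mul1mx.
have jj v : j (j v) = - v by rewrite /j mulmxA J2 mulNmx mul1mx.
have ji v : j (i v) = - i (j v) by rewrite /i /j !mulmxA IJ mulNmx opprK.
have pi x v : p x (i v) = - i (p x v).
  rewrite /p /i !mulmxA -mulNmx; congr (_ *m _).
  rewrite mulmx_suml mulmx_sumr -sumrN; apply: eq_bigr => l _.
  by rewrite -scalemxAl -scalemxAr PI scalerN.
have qj x v : q x (j v) = - j (q x v).
  rewrite /q /j !mulmxA -mulNmx; congr (_ *m _).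
  rewrite mulmx_suml mulmx_sumr -sumrN; apply: eq_bigr => l _.
  by rewrite -scalemxAl -scalemxAr QJ scalerN.
have qi x v : q x (i v) = - p x (j v) - i (q x v) - j (p x v).
  rewrite /q /p /i /j !mulmxA -opprD -mulmxDl -mulNmx -mulmxBl; congr (_ *m _).
  rewrite !mulmx_suml !mulmx_sumr -!big_split -!sumrN -big_split; apply: eq_bigr => l _
    /=.
  rewrite -!scalemxAl -!scalemxAr -!scalerDr -!scalerN -scalerDr; congr (_ *: _).
  by rewrite PQ opprK addrK.
pose ob := twice_obata i j p q.
pose G l : 'M[C]_N := 2^-1 *: (- (I *m act_at P (delta_mx l 0)) - J *m Q l
  + I *m J *m lincomb_mx Q (I *m delta_mx l 0) - I *m J *m act_at P (delta_mx l 0) *m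
    J).
have GE l y : G l *m y = 2^-1 *: ob (delta_mx l 0) y.
  rewrite /G -scalemxAl !(mulmxDl, mulNmx); congr (_ *: _).
  rewrite /ob /twice_obata /kk /i /j /p /q (lincomb_mxE P y) (lincomb_mxE P (J *m y)).
  by rewrite lincomb_mx_delta !mulmxA.
exists G; split=> [k l|l|l].
- rewrite !colE !GE; congr (_ *: _); apply/eqP; rewrite -subr_eq0; apply/eqP.
  rewrite /ob twice_obata_sym //.
  have -> : forall x y, nijenhuis_of (kk i j) (kd i j p q) x y = 0.
    move=> x y; rewrite -[RHS](NK x y) /nijenhuis_mx /nijenhuis_of /kd /kk /p /q /i /j.
    have SE x' y' : lincomb_mx (fun l => P l *m J + I *m Q l) x' *m y' =
       lincomb_mx P x' *m (J *m y') + I *m (lincomb_mx Q x' *m y').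
      rewrite !mulmxA -mulmxDl; congr (_ *m _).
      rewrite mulmx_suml mulmx_sumr -big_split; apply: eq_bigr => r _ /=.
      by rewrite scalerDr -scalemxAl -scalemxAr.
    by rewrite !SE !mulmxA.
  rewrite -/(nijenhuis_mx I P _ _) -/(nijenhuis_mx J Q _ _) NI NJ /kk /i /j.
  by rewrite !mulmx0 !addr0 oppr0.
- apply: mulmx_ext => y; rewrite mulmxBl -!mulmxA !GE -scalemxAr -scalerBr.
  pose d : 'cV[C]_N := delta_mx l 0.
  have obI : p d y + p d y + ob d (i y) - i (ob d y)
      = - (nijenhuis_of i p d (i y) + j (nijenhuis_of i p d (kk i j y))) by apply:
        twice_obata_I.
  rewrite -[nijenhuis_of i p _ (i y)]/(nijenhuis_mx I P _ _) -[nijenhuis_of i p _ (kk _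
    _ y)]/(nijenhuis_mx I P _ _) in obI.
  rewrite !NI /j mulmx0 addr0 oppr0 in obI.
  have {obI} -> : I *m ob (delta_mx l 0) y = p (delta_mx l 0) y + p (delta_mx l 0) y
      + ob (delta_mx l 0) (I *m y).
    by apply/eqP; rewrite -subr_eq0 -opprB oppr_eq0; apply/eqP.
  by rewrite addrK half_double /p lincomb_mx_delta.
apply: mulmx_ext => y; rewrite mulmxBl -!mulmxA !GE -scalemxAr -scalerBr.
pose d : 'cV[C]_N := delta_mx l 0.
have obJ : q d y + q d y + ob d (j y) = j (ob d y) by apply: twice_obata_J.
rewrite /j -/d in obJ; rewrite -/d -obJ.
by rewrite addrK half_double /q lincomb_mx_delta.
Qed.
End ObataMatrices.

Local Open Scope classical_set_scope.
Local Open Scope complex_scope.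

(** * Directional derivatives of continuously differentiable functions *)

Section DirectionalDerivative.
Variables (R : realType) (V : normedModType R).

Lemma derive_along_line (f : V -> R) (e y : V) (t : R) :
  derivable f (t *: e + y) e ->
  is_derive t (1 : R) (fun s : R => f (s *: e + y)) ('D_e f (t *: e + y)).
Proof.
have E : (fun h : R => h^-1 *: (((fun s : R => f (s *: e + y)) \o shift t) (h *: 1) -
    f (t *: e + y))) =
    (fun h => h^-1 *: ((f \o shift (t *: e + y)) (h *: e) - f (t *: e + y))).
  by apply/funext=> h /=; rewrite /shift /= [h *: 1]mulr1 scalerDl addrA.
by move=> fd; split; rewrite /derivable /derive E.
Qed.

Lemma mean_value_line (f : V -> R) (e y : V) (t : R) :
  (forall s : R, `|s| <= `|t| -> derivable f (s *: e + y) e) ->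
  exists2 c, `|c| <= `|t| & f (t *: e + y) - f y = t * 'D_e f (c *: e + y).
Proof.
move=> fd; pose phi (s : R) := f (s *: e + y).
have phi0 : f y = phi 0 by rewrite /phi scale0r add0r.
have phid (s : R) : `|s| <= `|t| -> is_derive s (1 : R) phi ('D_e f (s *: e + y)).
  by move=> /fd/derive_along_line.
rewrite phi0 -/(phi t); have [t0|t0|<-] := ltrgtP 0 t.
- have [|| c] := @MVT R phi (fun s => 'D_e f (s *: e + y)) 0 t t0.
  + move=> s /[!in_itv]/= /andP[s0 st]; apply: phid.
    by rewrite !gtr0_norm // ltW.
  + apply: derivable_within_continuous => s /[!in_itv]/= /andP[s0 st].
    by case: (phid s _) => //; rewrite !ger0_norm // ltW.
  rewrite in_itv /= subr0 => /andP[c0 ct] ->; exists c; last by rewrite mulrC.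
  by rewrite !gtr0_norm // ltW.
- have [|| c] := @MVT R phi (fun s => 'D_e f (s *: e + y)) t 0 t0.
  + move=> s /[!in_itv]/= /andP[ts s0]; apply: phid.
    by rewrite !ltr0_norm // lerN2 ltW.
  + apply: derivable_within_continuous => s /[!in_itv]/= /andP[ts s0].
    by case: (phid s _) => //; rewrite !ler0_norm ?lerN2 // ltW.
  rewrite in_itv /= sub0r => /andP[tc c0] E; exists c.
    by rewrite !ltr0_norm // lerN2 ltW.
  by rewrite -opprB E mulrN opprK mulrC.
- by exists 0; rewrite ?lexx // subrr mul0r.
Qed.

(** The increment along c e, from a base point that moves with h, is a mean
    value of the derivative along e, which is continuous at x. *)
Lemma partial_increment (f : V -> R) (x w e : V) (c : R) :
  (\forall y \near x, derivable f y e) ->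
  {for x, continuous (fun y => 'D_e f y)} ->
  h^-1 *: (f (h *: (w + c *: e) + x) - f (h *: w + x)) @[h --> 0^'] --> c * 'D_e f x.
Proof.
move=> fd Dc; apply/cvgrPdist_le => eps eps0.
pose eps' := eps / (`|c| + 1).
have c1 : 0 < `|c| + 1 by rewrite ltr_wpDl.
have eps'0 : 0 < eps' by rewrite divr_gt0.
have near_x : \forall y \near x, derivable f y e /\ `|'D_e f x - 'D_e f y| <= eps'.
  apply: filterI => //.
  by move/cvgrPdist_le : Dc => /(_ _ eps'0).
have [d /= d0 xd] := (@nbhs_ballP _ _ _ _).1 near_x.
(* K bounds, per unit of h, the distance to x of the points concerned. *)
pose K := `|w| + `|c *: e| + 1.
have K0 : 0 < K by rewrite ltr_wpDl // addr_ge0.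
have inball (h s : R) : `|h| < d / K -> `|s| <= `|h * c| ->
    derivable f (s *: e + (h *: w + x)) e /\
    `|'D_e f x - 'D_e f (s *: e + (h *: w + x))| <= eps'.
  move=> hd sh; apply: xd; rewrite -ball_normE /ball_ /=.
  rewrite addrA opprD addrCA subrr addr0 normrN.
  apply: le_lt_trans (ler_normD _ _) _; rewrite !normrZ.
  apply: le_lt_trans (_ : `|h| * (`|c *: e| + `|w|) < _).
    rewrite mulrDr lerD2r normrZ mulrA -normrM ler_wpM2r //.
  rewrite ltr_pdivlMr // in hd.
  apply: le_lt_trans hd.
  by rewrite ler_wpM2l // /K [`|w| + _]addrC lerDl.
near=> h.
have h0 : h != 0 by near: h; exact: nbhs_dnbhs_neq.
have hd : `|h| < d / K.
  by near: h; apply: dnbhs0_lt; rewrite divr_gt0.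
have [|s sh E] := @mean_value_line f e (h *: w + x) (h * c).
  by move=> s sh; have [] := inball h s hd sh.
have -> : h *: (w + c *: e) + x = (h * c) *: e + (h *: w + x).
  by rewrite scalerDr scalerA addrA; congr (_ + _); rewrite addrC.
rewrite E [_ *: _]mulrA mulrA mulVf // mul1r -mulrBr normrM.
have [_ Dle] := inball h s hd sh.
apply: le_trans (ler_wpM2l (normr_ge0 c) Dle) _.
rewrite /eps' mulrCA; apply: ler_piMr; first exact: ltW.
by rewrite ler_pdivrMr // mul1r lerDl.
Unshelve. all: by end_near. Qed.

End DirectionalDerivative.

Lemma cvg_fsum (R : realType) (T I : Type) (F : set_system T) (r : seq I)
    (f : I -> T -> R) (l : I -> R) : Filter F ->
  (forall i, f i t @[t --> F] --> l i) ->
  \sum_(i <- r) f i t @[t --> F] --> \sum_(i <- r) l i.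
Proof.
move=> FF fl; elim: r => [|i r IH].
  rewrite big_nil; under eq_fun do rewrite big_nil; exact: cvg_cst.
rewrite big_cons; under eq_fun do rewrite big_cons; exact: cvgD.
Qed.

Section Smooth.
Variables (R : realType) (m : nat).
Implicit Types U : set 'cV[R]_m.

Lemma smooth_partial U (f : 'cV[R]_m -> R) x j : smooth_on U f -> U x ->
  is_derive x (basis_vec j) f (partial j f x).
Proof. by move=> fs Ux; have [_ /(_ j) fd] := fs [::] x Ux; split. Qed.

Lemma smooth_on_cst U (c : R) : smooth_on U (fun _ => c).
Proof.
have foldc (s : seq 'I_m) : exists c', foldr partial (fun=> c) s = fun=> c'.
  elim: s => [|j s [c' sE]]; first by exists c.
  exists 0; rewrite /= sE; apply/funext => x; exact: derive_cst.
move=> s x _; have [c' ->] := foldc s.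
by split; [exact: cst_continuous | move=> j; exact: derivable_cst].
Qed.

Lemma smooth_mx_on_cst U p q (A : 'M[R]_(p, q)) :
  smooth_mx_on U (fun _ : 'cV[R]_m => A).
Proof. by move=> i j; exact: smooth_on_cst. Qed.

(** The increment along v telescopes into increments along the coordinate
    axes. *)
Lemma smooth_derive U (f : 'cV[R]_m -> R) x (v : 'cV[R]_m) :
  open U -> smooth_on U f -> U x ->
  is_derive x v f (\sum_j v j 0 * partial j f x).
Proof.
move=> Uo fs Ux.
pose w k : 'cV[R]_m := \sum_(j < m | (j < k)%N) v j 0 *: basis_vec j.
have wS (k : 'I_m) : w k.+1 = w k + v k 0 *: basis_vec k.
  rewrite /w (bigD1 k) //= addrC; congr (_ + _); apply: eq_bigl => j.
  by rewrite ltnS leq_eqVlt -val_eqE /=; case: ltngtP.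
have w0 : w 0%N = 0 by rewrite /w big1.
have wm : w m = v.
  rewrite [RHS]col_sum /w; apply: eq_bigl => j; exact: ltn_ord.
have lim_h : h^-1 *: (f (h *: v + x) - f x) @[h --> 0^'] -->
    \sum_j v j 0 * partial j f x.
  (* w k keeps the first k coordinates of v. *)
  have -> : (fun h : R => h^-1 *: (f (h *: v + x) - f x)) =
      fun h => \sum_(k < m) h^-1 *: (f (h *: (w k + v k 0 *: basis_vec k) + x) - f (h
        *: w k + x)).
    apply/funext => h; rewrite -scaler_sumr; congr (_ *: _).
    rewrite -[in LHS]wm -[f x](_ : f (h *: w 0%N + x) = _); last first.
      by rewrite w0 scaler0 add0r.
    rewrite -(@telescope_sumr _ 0 m (fun k => f (h *: w k + x))) // big_mkord.
    by apply: eq_bigr => k _; rewrite wS.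
  apply: cvg_fsum => k; apply: partial_increment.
    by apply: filterS (open_nbhs_nbhs (conj Uo Ux)) => y Uy; case: (smooth_partial k fs
      Uy).
  by have [] := fs [:: k] x Ux.
split; first by apply/cvg_ex; eexists; exact: lim_h.
exact/cvg_lim/lim_h.
Qed.

End Smooth.

(** * Derivatives of matrix-valued and complex-valued functions *)

Section MatrixDerivative.
Variables (R : realType) (V : normedModType R) (x v : V).

Lemma is_derive_fsum (I : Type) (r : seq I) (f : I -> V -> R) (df : I -> R) :
  (forall i, is_derive x v (f i) (df i)) ->
  is_derive x v (fun y => \sum_(i <- r) f i y) (\sum_(i <- r) df i).
Proof.
move=> fd; elim: r => [|i r IH].
  rewrite big_nil; under eq_fun do rewrite big_nil; exact: is_derive_cst.
rewrite big_cons; under eq_fun do rewrite big_cons; exact: is_deriveD.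
Qed.

Lemma is_derive_fmul (f h : V -> R) df dh :
  is_derive x v f df -> is_derive x v h dh ->
  is_derive x v (fun y => f y * h y) (df * h x + f x * dh).
Proof.
move=> fd hd; apply: (is_derive_eq (is_deriveM fd hd)).
by rewrite /GRing.scale /= addrC [h x * _]mulrC.
Qed.

Definition mxder p q (A : V -> 'M[R]_(p, q)) (D : 'M[R]_(p, q)) : Prop :=
  forall a b, is_derive x v (fun y => A y a b) (D a b).

Lemma mxder_near p q (A B : V -> 'M[R]_(p, q)) D D' :
  (\near x, A x = B x) -> mxder A D -> mxder B D' -> D = D'.
Proof.
move=> AB Ad Bd; apply/matrixP=> a b.
have [_ <-] := Ad a b; have [_ <-] := Bd a b.
by apply: near_eq_derive; apply: filterS AB => y ->.
Qed.

Lemma mxder_cst p q (A : 'M[R]_(p, q)) : mxder (fun=> A) 0.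
Proof. by move=> a b; rewrite mxE; exact: is_derive_cst. Qed.

Lemma mxder_mul p q r (A : V -> 'M[R]_(p, q)) (B : V -> 'M[R]_(q, r)) D D' :
  mxder A D -> mxder B D' -> mxder (fun y => A y *m B y) (D *m B x + A x *m D').
Proof.
move=> Ad Bd a b; rewrite !mxE -big_split /=; under eq_fun do rewrite mxE.
by apply: is_derive_fsum => k; exact: is_derive_fmul.
Qed.

Lemma mxder_tr p q (A : V -> 'M[R]_(p, q)) D : mxder A D -> mxder (fun y => (A y)^T)
  D^T.
Proof. by move=> Ad a b; rewrite mxE; under eq_fun do rewrite mxE; exact: Ad. Qed.

Lemma mxder_opp p q (A : V -> 'M[R]_(p, q)) D : mxder A D -> mxder (fun y => - A y) (-
  D).
Proof.
by move=> Ad a b; rewrite mxE; under eq_fun do rewrite mxE; exact: is_deriveN.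
Qed.

Lemma mxder_derive p q (A : V -> 'M[R]_(p, q)) D : mxder A D -> 'D_v A x = D.
Proof.
move=> Ad; rewrite derive_mx; last by apply/derivable_mxP=> a b; case: (Ad a b).
by apply/matrixP=> a b; rewrite mxE; case: (Ad a b).
Qed.

Definition cder (f : V -> R[i]) (d : R[i]) : Prop :=
  is_derive x v (fun y => complex.Re (f y)) (complex.Re d) /\
  is_derive x v (fun y => complex.Im (f y)) (complex.Im d).

Lemma cder_cst c : cder (fun=> c) 0.
Proof. by split; exact: is_derive_cst. Qed.

Lemma cderD f h df dh : cder f df -> cder h dh -> cder (fun y => f y + h y) (df + dh).
Proof.
have ReD (a b : R[i]) : complex.Re (a + b) = complex.Re a + complex.Re b by case: a b
  => ? ? [].
have ImD (a b : R[i]) : complex.Im (a + b) = complex.Im a + complex.Im b by case: a b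
  => ? ? [].
move=> [fr fi] [hr hi]; split.
  by rewrite ReD; under eq_fun do rewrite ReD; exact: is_deriveD.
by rewrite ImD; under eq_fun do rewrite ImD; exact: is_deriveD.
Qed.

Lemma cderM f h df dh : cder f df -> cder h dh ->
  cder (fun y => f y * h y) (df * h x + f x * dh).
Proof.
have ReM (a b : R[i]) : complex.Re (a * b) =
  complex.Re a * complex.Re b - complex.Im a * complex.Im b by case: a b => ? ? [].
have ImM (a b : R[i]) : complex.Im (a * b) =
  complex.Re a * complex.Im b + complex.Im a * complex.Re b by case: a b => ? ? [].
have ReD (a b : R[i]) : complex.Re (a + b) = complex.Re a + complex.Re b by case: a b
  => ? ? [].
have ImD (a b : R[i]) : complex.Im (a + b) = complex.Im a + complex.Im b by case: a b
  => ? ? [].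
move=> [fr fi] [hr hi]; split.
  under eq_fun do rewrite ReM; rewrite ReD !ReM.
  apply: (is_derive_eq (is_deriveB (is_derive_fmul fr hr) (is_derive_fmul fi hi))).
  ring.
under eq_fun do rewrite ImM; rewrite ImD !ImM.
apply: (is_derive_eq (is_deriveD (is_derive_fmul fr hi) (is_derive_fmul fi hr))).
ring.
Qed.

Lemma cderZ c f df : cder f df -> cder (fun y => c * f y) (c * df).
Proof. by move=> /(cderM (cder_cst c)); rewrite mul0r add0r. Qed.

Lemma cder_sum (I : Type) (r : seq I) (f : I -> V -> R[i]) df :
  (forall i, cder (f i) (df i)) ->
  cder (fun y => \sum_(i <- r) f i y) (\sum_(i <- r) df i).
Proof.
move=> fd; elim: r => [|i r IH].
  rewrite big_nil; under eq_fun do rewrite big_nil; exact: cder_cst.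
rewrite big_cons; under eq_fun do rewrite big_cons; exact: cderD.
Qed.

Definition cmxder p q (W : V -> 'M[R[i]]_(p, q)) (B : 'M[R[i]]_(p, q)) : Prop :=
  forall a b, cder (fun y => W y a b) (B a b).

Lemma cmxder_real p q (A : V -> 'M[R]_(p, q)) D : mxder A D ->
  cmxder (fun y => map_mx (real_complex R) (A y)) (map_mx (real_complex R) D).
Proof.
move=> Ad a b; rewrite mxE; under eq_fun do rewrite mxE.
by split; [exact: Ad | exact: is_derive_cst].
Qed.

Lemma cmxderD p q (W W' : V -> 'M[R[i]]_(p, q)) B B' :
  cmxder W B -> cmxder W' B' -> cmxder (fun y => W y + W' y) (B + B').
Proof. by move=> Wd Wd' a b; rewrite mxE; under eq_fun do rewrite mxE; exact: cderD.
  Qed.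

Lemma cmxderZ p q c (W : V -> 'M[R[i]]_(p, q)) B :
  cmxder W B -> cmxder (fun y => c *: W y) (c *: B).
Proof. by move=> Wd a b; rewrite mxE; under eq_fun do rewrite mxE; exact: cderZ. Qed.

Lemma bilinE N (W : 'M[R[i]]_N) w :
  bilin W w = \sum_b \sum_a w a 0 * w b 1 * W a b.
Proof.
rewrite /bilin mxE; apply: eq_bigr => b _; rewrite mxE mulr_suml; apply: eq_bigr => a _.
by rewrite !mxE mulrAC.
Qed.

Lemma cder_bilin N (W : V -> 'M[R[i]]_N) B w : cmxder W B ->
  cder (fun y => bilin (W y) w) (bilin B w).
Proof.
move=> Wd; rewrite bilinE; under eq_fun do rewrite bilinE.
by apply: cder_sum => b; apply: cder_sum => a; exact: cderZ.
Qed.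

Lemma cder_wedge_expn N (W : V -> 'M[R[i]]_N) B k w : cmxder W B ->
  cder (fun y => @wedge_expn _ N (W y) k w) (@wedge_expn_dir _ N (W x) B k w).
Proof.
move=> Wd; elim: k w => [w|k IH w]; first exact: cder_cst.
rewrite /= /wedge_at -mulrDr -big_split /=; apply: cderZ; apply: cder_sum => s.
rewrite -mulrDr; apply: cderZ; apply: cderM; first exact: cder_bilin.
exact: IH.
Qed.
End MatrixDerivative.

Section PartialDerivative.
Variables (R : realType) (m : nat).

Lemma cder_cpartial (f : 'cV[R]_m -> R[i]) x j d :
  cder x (basis_vec j) f d -> cpartial j f x = d.
Proof.
by rewrite /cpartial /partial => - [[_ ->] [_ ->]]; case: d.
Qed.

Definition partial_mx p q (A : 'cV[R]_m -> 'M[R]_(p, q)) (x : 'cV[R]_m) (j : 'I_m) :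
  'M[R]_(p, q) :=
  \matrix_(a, b) partial j (fun y => A y a b) x.

Lemma smooth_mxder U p q (A : 'cV[R]_m -> 'M[R]_(p, q)) x j :
  smooth_mx_on U A -> U x -> mxder x (basis_vec j) A (partial_mx A x j).
Proof. by move=> As Ux a b; rewrite mxE; apply: smooth_partial Ux. Qed.

Lemma smooth_mxder_dir U (A : 'cV[R]_m -> 'M[R]_m) x v :
  open U -> smooth_mx_on U A -> U x ->
  mxder x v A (lincomb_mx (partial_mx A x) v).
Proof.
move=> Uo As Ux a b; rewrite summxE.
under eq_bigr do rewrite mxE [partial_mx _ _ _ _ _]mxE.
exact: smooth_derive Uo (As a b) Ux.
Qed.

(** The Nijenhuis tensor is tensorial, so constant vector fields lose nothing;
    for them it involves only the first derivatives of A. *)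
Lemma nijenhuis_cst U (A : 'cV[R]_m -> 'M[R]_m) x (X Y : 'cV[R]_m) :
  open U -> smooth_mx_on U A -> U x ->
  nijenhuis A (fun=> X) (fun=> Y) x = nijenhuis_mx (A x) (partial_mx A x) X Y.
Proof.
move=> Uo As Ux.
have dA v Z : 'D_v (appf A (fun=> Z)) x = lincomb_mx (partial_mx A x) v *m Z.
  apply: mxder_derive; rewrite -[X in mxder _ _ _ X]addr0 -(mulmx0 _ (A x)).
  by apply: mxder_mul; [exact: (smooth_mxder_dir v Uo As Ux) | exact: mxder_cst].
have d0 v Z : 'D_v (fun=> Z : 'cV[R]_m) x = 0 by exact: derive_cst.
rewrite /nijenhuis /nijenhuis_mx /nijenhuis_of /appf /lie_bracket -/(appf A (fun=> X))
  -/(appf A (fun=> Y)).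
by rewrite !dA !d0 !(subr0, sub0r) mulmxN opprK addrAC.
Qed.

End PartialDerivative.

(** * Pointwise identities in a chart *)

Section DerLinear.
Variable C : numFieldType.

Lemma gl_actDl N k (X Y : 'M[C]_N) (f : 'M[C]_(N, k) -> C) v : multilinear f ->
  gl_act (X + Y) f v = gl_act X f v + gl_act Y f v.
Proof.
by move=> fm; rewrite -big_split; apply: eq_bigr => i _; rewrite mulmxDl multilinearD.
Qed.

Lemma gl_actZl N k c (X : 'M[C]_N) (f : 'M[C]_(N, k) -> C) v : multilinear f ->
  gl_act (c *: X) f v = c * gl_act X f v.
Proof.
by move=> fm; rewrite mulr_sumr; apply: eq_bigr => i _; rewrite -scalemxAl multilinearZ.
Qed.

Lemma gl_act_suml N k (I : finType) (X : I -> 'M[C]_N) (f : 'M[C]_(N, k) -> C) v :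
  multilinear f -> gl_act (\sum_l X l) f v = \sum_l gl_act (X l) f v.
Proof.
move=> fm; rewrite /gl_act exchange_big; apply: eq_bigr => i _ /=.
by rewrite mulmx_suml multilinear_sum.
Qed.

Lemma ext_diff_wedge_expn_trace N k (Nk : N = (2 + k * 2)%N) (W : 'M[C]_N)
    (E : 'I_N -> 'M[C]_N) :
  W^T = - W -> W \in unitmx -> (forall j, (E j)^T *m W = W *m E j) ->
  (forall v, ext_diff (fun j => gl_act (E j) (@wedge_expn C N W k)) v = 0) <->
  (forall i, \tr (E i) = 2 * \sum_j E j j i).
Proof. subst N; exact: ext_diff_wedge_expn_eq0P. Qed.
End DerLinear.

Section RealRows.
Variable R : realType.
Local Notation to_C := (map_mx (real_complex R)).

Lemma sqri : 'i * 'i = -1 :> R[i].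
Proof. by rewrite -expr2 sqr_i. Qed.

Lemma real_row_p10 m (t : 'rV[R]_m) (I : 'M[R]_m) :
  to_C t *m p10 'i (to_C I) = 0 -> t = 0.
Proof.
rewrite /p10 -scalemxAr mulmxBr mulmx1 -scalemxAr -map_mxM => /eqP.
rewrite scaler_eq0 invr_eq0 pnatr_eq0 /= => /eqP t0; apply/rowP=> b.
have /matrixP/(_ 0 b) := t0; rewrite !mxE => /(congr1 (@complex.Re R)) /=.
by rewrite !(mul0r, mul1r, mulr0, subr0, oppr0, addr0, add0r).
Qed.

Lemma real_row_p01 m (t : 'rV[R]_m) (I : 'M[R]_m) :
  to_C t *m p01 'i (to_C I) = 0 -> t = 0.
Proof.
rewrite /p01 -scalemxAr mulmxDr mulmx1 -scalemxAr -map_mxM => /eqP.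
rewrite scaler_eq0 invr_eq0 pnatr_eq0 /= => /eqP t0; apply/rowP=> b.
have /matrixP/(_ 0 b) := t0; rewrite !mxE => /(congr1 (@complex.Re R)) /=.
by rewrite !(mul0r, mul1r, mulr0, subr0, oppr0, addr0, add0r).
Qed.
End RealRows.

Section Pointwise.
Variables (R : realType) (m : nat) (M : manifold R m).
Variables (H : hypercomplex M) (g : quaternionic_hermitian H).
Variables (a : chart_index M).
Local Notation to_C := (map_mx (real_complex R)).
Local Notation U := (dom a).
Local Notation I := (cI H a).
Local Notation J := (cJ H a).
Local Notation K := (cK H a).
Local Notation gm := (metric g a).

Lemma dom_open : open U.
Proof. exact: chart_cod_open. Qed.

Lemma smooth_I : smooth_mx_on U I. Proof. by have [[[h _] _] _] := cI_integrable H. Qed.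
Lemma smooth_J : smooth_mx_on U J. Proof. by have [[[h _] _] _] := cJ_integrable H. Qed.
Lemma smooth_K : smooth_mx_on U K. Proof. by have [[[h _] _] _] := cK_integrable H. Qed.
Lemma smooth_metric : smooth_mx_on U gm. Proof. by have [] := metric_riemannian g. Qed.

Lemma I_sq x : U x -> I x *m I x = - 1%:M.
Proof. by have [[_ h] _] := cI_integrable H; exact: h. Qed.
Lemma J_sq x : U x -> J x *m J x = - 1%:M.
Proof. by have [[_ h] _] := cJ_integrable H; exact: h. Qed.
Lemma K_sq x : U x -> K x *m K x = - 1%:M.
Proof. by have [[_ h] _] := cK_integrable H; exact: h. Qed.

Lemma K_IJ x : U x -> K x = I x *m J x.
Proof.
move=> Ux; have := congr1 (mulmxr (K x)) (cIJK H Ux); rewrite /= -mulmxA K_sq //.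
by rewrite mulmxN mulmx1 mulNmx mul1mx => /oppr_inj.
Qed.

Lemma IJ_anti x : U x -> I x *m J x = - (J x *m I x).
Proof.
move=> Ux; have := K_sq Ux; rewrite K_IJ // => KK.
have := congr1 (fun A => I x *m A *m J x) KK.
rewrite /= !mulmxA I_sq // -(mulmxA _ (J x) (J x)) J_sq // !mulNmx !mulmxN !mulNmx.
by rewrite !mulmx1 !mul1mx opprK => ->; rewrite opprK.
Qed.

Lemma metric_sym x : U x -> (gm x)^T = gm x.
Proof. by have [_ _ h _] := metric_riemannian g; exact: h. Qed.

Lemma metric_unit x : U x -> gm x \in unitmx.
Proof.
move=> Ux; have [_ _ _ gpos] := metric_riemannian g.
rewrite -row_free_unit; apply: inj_row_free => u ug; apply: contraTeq isT => u0.
have := gpos a x u^T Ux; rewrite trmxK ug mul0mx mxE ltxx.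
have uT0 : u^T != 0 by apply: contraNneq u0 => uT; rewrite -[u]trmxK uT trmx0.
by move=> /(_ uT0).
Qed.

Lemma metric_I x : U x -> (I x)^T *m gm x = - (gm x *m I x).
Proof.
move=> Ux.
(* Invariance under the unit quaternion i. *)
have := @metric_invariant _ _ _ _ g 0 1 0 0 _ a x Ux.
rewrite !expr0n expr1n /= !addr0 add0r !scale0r !addr0 scale1r raddf0 add0r.
move=> /(_ erefl) gI; rewrite -[X in - (X *m _)]gI -!mulmxA I_sq //.
by rewrite !mulmxN mulmx1 opprK.
Qed.

Lemma metric_J x : U x -> (J x)^T *m gm x = - (gm x *m J x).
Proof.
move=> Ux.
(* Invariance under the unit quaternion j. *)
have := @metric_invariant _ _ _ _ g 0 0 1 0 _ a x Ux.
rewrite !expr0n expr1n /= !addr0 !add0r !scale0r !addr0 scale1r raddf0 !add0r.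
move=> /(_ erefl) gJ; rewrite -[X in - (X *m _)]gJ -!mulmxA J_sq //.
by rewrite !mulmxN mulmx1 opprK.
Qed.

Lemma near_dom x (P : 'cV[R]_m -> Prop) : U x -> (forall y, U y -> P y) ->
  \near x, P x.
Proof. by move=> Ux PU; apply: filterS (open_nbhs_nbhs (conj dom_open Ux)). Qed.

End Pointwise.

(** * The metric relative to a symmetric quaternionic connection *)

Section Pointwise.
Variables (R : realType) (m : nat) (M : manifold R m).
Variables (H : hypercomplex M) (g : quaternionic_hermitian H).
Variables (a : chart_index M).
Local Notation to_C := (map_mx (real_complex R)).
Local Notation U := (dom a).
Local Notation I := (cI H a).
Local Notation J := (cJ H a).
Local Notation K := (cK H a).
Local Notation gm := (metric g a).

Definition ThetaC y : 'M[R[i]]_m := to_C (gm y *m J y) + 'i *: to_C (gm y *m K y).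
Definition omC y : 'M[R[i]]_m := to_C (gm y *m I y).

Lemma Omega_bilin y w : Omega g a y w = bilin (ThetaC y) w.
Proof.
rewrite /Omega /form_add /form_scale /omegaJ /omegaK /form_of /bilin /ThetaC.
rewrite !map_mxM mulmxDr mulmxDl -scalemxAr -scalemxAl [RHS]mxE !mulmxA.
by congr (_ + _); rewrite [RHS]mxE.
Qed.

Lemma omegaI_bilin y w : omegaI g a y w = bilin (omC y) w.
Proof. by rewrite /omegaI /form_of /bilin /omC map_mxM !mulmxA. Qed.

Lemma wedge_pow_wedge_expn (f : kform M 2) (W : 'cV[R]_m -> 'M[R[i]]_m) k y w :
  (forall y w, f a y w = bilin (W y) w) ->
  wedge_pow f k a y w = @wedge_expn _ m (W y) k w.
Proof.
move=> fW; elim: k w => //= k IH w.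
by apply: (@eq_wedge_at _ m 2 (k * 2)) => z; [exact: fW | exact: IH].
Qed.

Variables (x : 'cV[R]_m) (Ux : U x).

Lemma anti_der (A : 'cV[R]_m -> 'M[R]_m) (D : 'I_m -> 'M[R]_m) l :
  (forall y, U y -> A y *m A y = - 1%:M) -> mxder x (basis_vec l) A (D l) ->
  D l *m A x = - (A x *m D l).
Proof.
move=> A2 Ad; apply/eqP; rewrite -addr_eq0; apply/eqP.
apply: (mxder_near _ (mxder_mul Ad Ad) (mxder_cst x (basis_vec l) (- 1%:M))).
exact: near_dom Ux A2.
Qed.

Local Notation P := (partial_mx I x).
Local Notation Q := (partial_mx J x).
Local Notation dmetric := (partial_mx gm x).

Lemma I_mxder l : mxder x (basis_vec l) I (P l).
Proof. exact (@smooth_mxder R m U m m I x l (@smooth_I _ _ _ H a) Ux). Qed.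

Lemma J_mxder l : mxder x (basis_vec l) J (Q l).
Proof. exact (@smooth_mxder R m U m m J x l (@smooth_J _ _ _ H a) Ux). Qed.

Lemma metric_mxder l : mxder x (basis_vec l) gm (dmetric l).
Proof. exact (@smooth_mxder R m U m m gm x l (@smooth_metric _ _ _ _ g a) Ux). Qed.

Lemma PI_anti l : P l *m I x = - (I x *m P l).
Proof. by apply: anti_der (I_mxder l) => y; apply: I_sq. Qed.

Lemma QJ_anti l : Q l *m J x = - (J x *m Q l).
Proof. by apply: anti_der (J_mxder l) => y; apply: J_sq. Qed.

Lemma PQ_anti l : P l *m J x + I x *m Q l = - (Q l *m I x + J x *m P l).
Proof.
apply: (mxder_near _ (mxder_mul (I_mxder l) (J_mxder l)) (mxder_opp (mxder_mul (J_mxder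
  l) (I_mxder l)))).
by apply: near_dom Ux _ => y; apply: IJ_anti.
Qed.

Lemma partial_K l : partial_mx K x l = P l *m J x + I x *m Q l.
Proof.
apply: (mxder_near _ (@smooth_mxder R m U m m K x l (@smooth_K _ _ _ H a) Ux)
  (mxder_mul (I_mxder l) (J_mxder l))).
by apply: near_dom Ux _ => y; apply: K_IJ.
Qed.

Lemma partial_metric_sym l : (dmetric l)^T = dmetric l.
Proof.
apply: (mxder_near _ (mxder_tr (metric_mxder l)) (metric_mxder l)).
by apply: near_dom Ux _ => y; apply: metric_sym.
Qed.

Lemma partial_metric_anti (A : 'cV[R]_m -> 'M[R]_m) (D : 'I_m -> 'M[R]_m) l :
  (forall y, U y -> (A y)^T *m gm y = - (gm y *m A y)) ->
  mxder x (basis_vec l) A (D l) ->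
  (D l)^T *m gm x + (A x)^T *m dmetric l = - (dmetric l *m A x + gm x *m D l).
Proof.
move=> Ag Ad.
apply: (mxder_near _ (mxder_mul (mxder_tr Ad) (metric_mxder l)) (mxder_opp (mxder_mul
  (metric_mxder l) Ad))).
exact: near_dom Ux Ag.
Qed.

Lemma obata_at :
  exists G : 'I_m -> 'M[R]_m,
    [/\ forall k l, col k (G l) = col l (G k),
        forall l, P l = I x *m G l - G l *m I x &
        forall l, Q l = J x *m G l - G l *m J x].
Proof.
have nij0 (A : components M) : integrable_acs A ->
    forall X Y, nijenhuis_mx (A a x) (partial_mx (A a) x) X Y = 0.
  move=> [[[As _] _] An] X Y.
  rewrite -(nijenhuis_cst X Y (@dom_open _ _ M a) (As a) Ux).
  by apply: An => //; exact: smooth_mx_on_cst.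
apply: (obata_exists (I_sq H Ux) (J_sq H Ux) (IJ_anti H Ux) PI_anti QJ_anti PQ_anti).
- exact: nij0 (cI_integrable H).
- exact: nij0 (cJ_integrable H).
- move=> X Y; have := nij0 _ (cK_integrable H) X Y; rewrite K_IJ // => <-.
  by rewrite (_ : partial_mx K x = fun l => P l *m J x + I x *m Q l) //; apply/funext=>
    l; exact: partial_K.
Qed.

Variables (G : 'I_m -> 'M[R]_m).
Hypothesis Gsym : forall k l, col k (G l) = col l (G k).
Hypothesis GI : forall l, P l = I x *m G l - G l *m I x.
Hypothesis GJ : forall l, Q l = J x *m G l - G l *m J x.

Definition nabla_g l : 'M[R]_m := dmetric l - (G l)^T *m gm x - gm x *m G l.
Definition nonmetricity l : 'M[R]_m := invmx (gm x) *m nabla_g l.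

Lemma nabla_g_sym l : (nabla_g l)^T = nabla_g l.
Proof.
rewrite /nabla_g !linearB /= !trmx_mul trmxK partial_metric_sym metric_sym //.
by rewrite addrAC.
Qed.

Lemma nonmetricity_g l : (nonmetricity l)^T *m gm x = gm x *m nonmetricity l.
Proof.
rewrite /nonmetricity trmx_mul nabla_g_sym trmx_inv metric_sym // mulmxKV ?mulKVmx
  ?metric_unit //.
Qed.

(** Differentiate the invariance of g under the parallel endomorphism A. *)
Lemma nabla_g_anti (A D : 'M[R]_m) l :
  D = A *m G l - G l *m A -> A^T *m gm x = - (gm x *m A) ->
  D^T *m gm x + A^T *m dmetric l = - (dmetric l *m A + gm x *m D) ->
  A^T *m nabla_g l = - (nabla_g l *m A).
Proof.
move=> DE Ag; have gA := Ag.
move=> Dg; apply/eqP; rewrite -addr_eq0; apply/eqP.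
have {Dg} : D^T *m gm x + A^T *m dmetric l + (dmetric l *m A + gm x *m D) = 0.
  by rewrite Dg addNr.
rewrite DE linearB /= !trmx_mul !(mulmxBl, mulmxBr) -!mulmxA Ag !mulmxN !mulmxA.
rewrite Ag !mulNmx => E; rewrite -[RHS]E /nabla_g.
apply/matrixP=> i j.
have e (X Y : 'M[R]_m) : (X + Y) i j = X i j + Y i j by rewrite mxE.
have e' (X : 'M[R]_m) : (- X) i j = - X i j by rewrite mxE.
by rewrite !(e, e'); ring.
Qed.

Lemma nonmetricity_comm (A D : 'M[R]_m) l :
  D = A *m G l - G l *m A -> A^T *m gm x = - (gm x *m A) ->
  D^T *m gm x + A^T *m dmetric l = - (dmetric l *m A + gm x *m D) ->
  nonmetricity l *m A = A *m nonmetricity l.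
Proof.
move=> DE Ag Dg; have SA := nabla_g_anti DE Ag Dg.
have gu := metric_unit g Ux.
have gA : invmx (gm x) *m A^T = - (A *m invmx (gm x)).
  by rewrite -[LHS](mulmxK gu) -[_ *m gm x]mulmxA Ag mulmxN mulNmx mulKmx.
rewrite /nonmetricity -mulmxA -[nabla_g l *m A]opprK -SA mulmxN !mulmxA gA mulNmx opprK.
by [].
Qed.

Lemma nonmetricity_I l : nonmetricity l *m I x = I x *m nonmetricity l.
Proof. by apply: nonmetricity_comm (GI l) (metric_I g Ux) (partial_metric_anti
  (@metric_I _ _ _ _ g a) (I_mxder l)). Qed.

Lemma nonmetricity_J l : nonmetricity l *m J x = J x *m nonmetricity l.
Proof. by apply: nonmetricity_comm (GJ l) (metric_J g Ux) (partial_metric_anti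
  (@metric_J _ _ _ _ g a) (J_mxder l)). Qed.

(** The infinitesimal linear transformation that the partial derivative l
    induces on g(-, A -): that of the connection together with half of the
    nonmetricity. *)
Definition frame_gen l : 'M[R]_m := G l + 2^-1 *: nonmetricity l.

(** The factor 1/2 is split evenly between the two arguments, since E is self-
    adjoint and commutes with A. *)
Lemma partial_metric_mul (A D : 'M[R]_m) l :
  D = A *m G l - G l *m A -> nonmetricity l *m A = A *m nonmetricity l ->
  dmetric l *m A + gm x *m D = (frame_gen l)^T *m (gm x *m A) + gm x *m A *m frame_gen
    l.
Proof.
move=> -> EA; have gu := metric_unit g Ux.
have gE : gm x *m nonmetricity l = nabla_g l by rewrite /nonmetricity mulKVmx.
have EgA : (nonmetricity l)^T *m (gm x *m A) = nabla_g l *m A.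
  by rewrite mulmxA nonmetricity_g gE.
have gAE : gm x *m A *m nonmetricity l = nabla_g l *m A by rewrite -mulmxA -EA mulmxA
  gE.
have frame_genT : (frame_gen l)^T = (G l)^T + 2^-1 *: (nonmetricity l)^T.
  by apply/matrixP=> i j; rewrite !mxE.
rewrite frame_genT /frame_gen [in RHS]mulmxDl [in RHS]mulmxDr -scalemxAl -scalemxAr EgA
  gAE.
rewrite addrACA -scalerDr half_double /nabla_g !mulmxBl !mulmxBr !mulmxA.
apply/matrixP=> i j.
have e (X Y : 'M[R]_m) : (X + Y) i j = X i j + Y i j by rewrite mxE.
have e' (X : 'M[R]_m) : (- X) i j = - X i j by rewrite mxE.
by rewrite !(e, e'); ring.
Qed.

Lemma comm_mulmx (E A B : 'M[R]_m) : E *m A = A *m E -> E *m B = B *m E ->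
  E *m (A *m B) = A *m B *m E.
Proof. by move=> EA EB; rewrite mulmxA EA -mulmxA EB mulmxA. Qed.

Local Notation frame_genC l := (to_C (frame_gen l)).

Lemma omC_cder l : cmxder x (basis_vec l) omC ((frame_genC l)^T *m omC x + omC x *m
  frame_genC l).
Proof.
have /cmxder_real := mxder_mul (metric_mxder l) (I_mxder l).
by rewrite (partial_metric_mul (GI l) (nonmetricity_I l)) map_mxD !map_mxM -map_trmx
  -!map_mxM.
Qed.

Lemma ThetaC_cder l :
  cmxder x (basis_vec l) ThetaC ((frame_genC l)^T *m ThetaC x + ThetaC x *m frame_genC
    l).
Proof.
have GK : partial_mx K x l = K x *m G l - G l *m K x.
  rewrite partial_K GI GJ K_IJ // mulmxBl mulmxBr !mulmxA addrC addrA subrK.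
  by [].
have EK : nonmetricity l *m K x = K x *m nonmetricity l.
  by rewrite K_IJ //; apply: comm_mulmx; [exact: nonmetricity_I | exact:
    nonmetricity_J].
have J_mxder' := cmxder_real (mxder_mul (metric_mxder l) (J_mxder l)).
have partial_K' := cmxder_real (mxder_mul (metric_mxder l) (@smooth_mxder R m U m m K x
  l (@smooth_K _ _ _ H a) Ux)).
have := cmxderD J_mxder' (cmxderZ 'i partial_K').
rewrite (partial_metric_mul (GJ l) (nonmetricity_J l)) (partial_metric_mul GK EK)
  !(map_mxD _ ((_)^T *m _)).
rewrite !(map_mxM _ _ (gm x *m _)) !(map_mxM _ _ (frame_gen l)) map_trmx /ThetaC.
rewrite mulmxDr mulmxDl -scalemxAr -scalemxAl scalerDr addrACA.
by [].
Qed.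

Local Notation EC l := (to_C (nonmetricity l)).

(** The part of the action that comes from the connection cancels by
    [ext_diff_symmetric]. *)
Lemma ext_d_frame k (f : kform M k) (F : 'M[R[i]]_(m, k) -> R[i]) :
  multilinear F -> alternating F ->
  (forall l w, cder x (basis_vec l) (fun y => f a y w) (gl_act (frame_genC l) F w)) ->
  forall v, ext_d f a x v = 2^-1 * ext_diff (fun l => gl_act (EC l) F) v.
Proof.
move=> Fm Fa fF v.
have -> : ext_d f a x v = ext_diff (fun l => gl_act (frame_genC l) F) v.
  apply: eq_bigr => i _; congr (_ * _); apply: eq_bigr => l _; congr (_ * _).
  exact: cder_cpartial (fF l _).
have frame_genE l w : gl_act (frame_genC l) F w = gl_act (to_C (G l)) F w + 2^-1 *
  gl_act (EC l) F w.
  have -> : frame_genC l = to_C (G l) + 2^-1 *: EC l.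
    by rewrite /frame_gen map_mxD map_mxZ /= fmorphV rmorph_nat.
  by rewrite gl_actDl // gl_actZl.
transitivity (ext_diff (fun l => gl_act (to_C (G l)) F) v + ext_diff (fun l w => 2^-1 *
  gl_act (EC l) F w) v).
  rewrite -ext_diffD; exact: eq_ext_diff.
have d0 : ext_diff (fun l => gl_act (to_C (G l)) F) v = 0.
  apply: ext_diff_symmetric Fm Fa => i j.
  apply/matrixP=> p q; rewrite !mxE; congr (_%:C).
  by have /matrixP/(_ p 0) := Gsym i j; rewrite !mxE.
by rewrite -[RHS]ext_diffZ -[RHS]add0r; congr (_ + _).
Qed.

Lemma wedge_pow_cder (f : kform M 2) (W : 'cV[R]_m -> 'M[R[i]]_m) k :
  (forall y w, f a y w = bilin (W y) w) ->
  (forall l, cmxder x (basis_vec l) W ((frame_genC l)^T *m W x + W x *m frame_genC l))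
    ->
  forall l w, cder x (basis_vec l) (fun y => wedge_pow f k a y w)
    (gl_act (frame_genC l) (@wedge_expn _ m (W x) k) w).
Proof.
move=> fW Wd l w; rewrite gl_act_wedge_expn.
under eq_fun do rewrite (wedge_pow_wedge_expn _ _ fW).
exact: cder_wedge_expn.
Qed.

Local Notation Ic := (to_C (I x)).
Local Notation Jc := (to_C (J x)).
Local Notation gc := (to_C (gm x)).

Lemma to_C1 : to_C (1%:M : 'M[R]_m) = 1%:M.
Proof. exact: map_mx1. Qed.

Lemma Ic_sq : Ic *m Ic = - 1%:M.
Proof. by rewrite -map_mxM I_sq // map_mxN to_C1. Qed.
Lemma Jc_sq : Jc *m Jc = - 1%:M.
Proof. by rewrite -map_mxM J_sq // map_mxN to_C1. Qed.
Lemma IJc : Ic *m Jc = - (Jc *m Ic).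
Proof. by rewrite -!map_mxM IJ_anti // map_mxN. Qed.
Lemma gc_sym : gc^T = gc.
Proof. by rewrite map_trmx metric_sym. Qed.
Lemma gc_unit : gc \in unitmx.
Proof. by rewrite map_unitmx metric_unit. Qed.
Lemma gIc : Ic^T *m gc = - (gc *m Ic).
Proof. by rewrite map_trmx -!map_mxM metric_I // map_mxN. Qed.
Lemma gJc : Jc^T *m gc = - (gc *m Jc).
Proof. by rewrite map_trmx -!map_mxM metric_J // map_mxN. Qed.
Lemma EgC l : (EC l)^T *m gc = gc *m EC l.
Proof. by rewrite map_trmx -!map_mxM nonmetricity_g. Qed.
Lemma EIC l : EC l *m Ic = Ic *m EC l.
Proof. by rewrite -!map_mxM nonmetricity_I. Qed.
Lemma EJC l : EC l *m Jc = Jc *m EC l.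
Proof. by rewrite -!map_mxM nonmetricity_J. Qed.

Local Notation Th := (Theta 'i Ic Jc gc).

Lemma ThetaCE : ThetaC x = Th.
Proof.
rewrite /Theta -(mulmxA gc) (J_p10 _ IJc) /p01 /ThetaC K_IJ // !map_mxM.
rewrite -scalemxAl -scalemxAr scalerA mulfV ?pnatr_eq0 // scale1r.
by rewrite mulmxDl mul1mx mulmxDr -scalemxAl -scalemxAr.
Qed.

Definition trace_row : 'rV[R]_m := \row_l \tr (nonmetricity l).
Definition divergence_row : 'rV[R]_m := \row_l \sum_j nonmetricity j j l.

Lemma tr_rowC : tr_row (fun l => EC l) = to_C trace_row.
Proof. by apply/rowP=> l; rewrite !mxE trace_map_mx. Qed.

Lemma div_rowC : div_row (fun l => EC l) = to_C divergence_row.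
Proof.
by apply/rowP=> l; rewrite !mxE rmorph_sum; apply: eq_bigr => j _; rewrite mxE.
Qed.

End Pointwise.

(** * Forms of type (k, 0) *)

Section TypeParts.
Variables (R : realType) (m : nat) (M : manifold R m).
Variables (A : components M) (a : chart_index M).
Local Notation to_C := (map_mx (real_complex R)).
Local Notation U := (dom a).

Lemma ext_d_near k (f h : kform M k) x v : U x ->
  (forall y, U y -> forall w, f a y w = h a y w) -> ext_d f a x v = ext_d h a x v.
Proof.
move=> Ux fh; apply: eq_bigr => i _; congr (_ * _); apply: eq_bigr => j _; congr (_ *
  _).
rewrite /cpartial /partial; congr (_ +i* _); apply: near_eq_derive;
  by apply: filterS (open_nbhs_nbhs (conj (@dom_open _ _ M a) Ux)) => y Uy; rewrite fh.
Qed.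

Lemma ext_d_eq0 k (f : kform M k) x v : U x ->
  (forall y, U y -> forall w, f a y w = 0) -> ext_d f a x v = 0.
Proof.
move=> Ux f0; rewrite (ext_d_near (h := fun _ _ _ => 0) _ Ux) //.
rewrite /ext_d big1 // => i _; rewrite /dir_deriv big1 ?mulr0 // => j _.
by rewrite (cder_cpartial (cder_cst _ _ 0)) mulr0.
Qed.

Hypothesis A2 : forall y, U y -> A a y *m A a y = - 1%:M.

Lemma A2C y : U y -> to_C (A a y) *m to_C (A a y) = - 1%:M.
Proof. by move=> Uy; rewrite -map_mxM A2 // map_mxN; congr (- _); exact: map_mx1. Qed.

Lemma type_partE k p (f : kform M k) y w :
  type_part A p f a y w =
  \sum_(S : {set 'I_k} | #|S| == p) f a y (type_mix 'i (to_C (A a y)) S w).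
Proof. by []. Qed.

Lemma type_part_full k (f : kform M k) y w :
  type_part A k f a y w = f a y (p10 'i (to_C (A a y)) *m w).
Proof.
rewrite type_partE (big_pred1 [set: 'I_k]%SET) => [|S].
  by congr (f a y _); apply/matrixP=> i j; rewrite mxE inE.
apply/eqP/eqP=> [Sk|->]; last by rewrite cardsT card_ord.
by apply/eqP; rewrite eqEcard finset.subsetT cardsT card_ord Sk leqnn.
Qed.

(** A form that factors through the projection to T^(1,0) is of type (k, 0).
    *)
Lemma type_part_holo k p (f : kform M k) y w : U y -> multilinear (f a y) ->
  (forall w, f a y (p10 'i (to_C (A a y)) *m w) = f a y w) ->
  type_part A p f a y w = if p == k then f a y w else 0.
Proof.
move=> Uy fm fp; case: eqP => [->|/eqP pk]; first by rewrite type_part_full fp.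
rewrite type_partE; apply: big1 => S /eqP Sp.
have [j _ jS] : exists2 j, j \in [set: 'I_k]%SET & j \notin S.
  apply/subsetPn; rewrite finset.subTset; apply: contra pk => /eqP ST.
  by rewrite -Sp ST cardsT card_ord.
rewrite -fp; apply: (multilinear_col0 fm (i := j)).
rewrite col_mulmx col_type_mix (negPf jS) mulmxA p10_01 ?mul0mx //.
- exact: sqri.
- exact: A2C.
Qed.

Lemma delbarE k (f : kform M k) x v : U x -> (forall y, U y -> multilinear (f a y)) ->
  (forall y, U y -> forall w, f a y (p10 'i (to_C (A a y)) *m w) = f a y w) ->
  delbar A f a x v =
  \sum_(S : {set 'I_k.+1} | #|S| == k) ext_d f a x (type_mix 'i (to_C (A a x)) S v).
Proof.
move=> Ux fm fp; rewrite /delbar big_ord_recr /= big1 => [|p _].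
  rewrite add0r type_partE; apply: eq_bigr => S _; apply: ext_d_near => // y Uy w.
  by rewrite type_part_holo ?eqxx //; [exact: fm | exact: fp].
rewrite type_partE; apply: big1 => S _; apply: ext_d_eq0 => // y Uy w.
rewrite type_part_holo //; [|exact: fm | exact: fp].
by rewrite ltn_eqF.
Qed.

Lemma delE k (f : kform M k) x v : U x -> (forall y, U y -> multilinear (f a y)) ->
  (forall y, U y -> forall w, f a y (p10 'i (to_C (A a y)) *m w) = f a y w) ->
  del A f a x v = ext_d f a x (p10 'i (to_C (A a x)) *m v).
Proof.
move=> Ux fm fp; rewrite /del big_ord_recr /= big1 => [|p _].
  rewrite add0r type_part_full; apply: ext_d_near => // y Uy w.
  by rewrite type_part_holo ?eqxx //; [exact: fm | exact: fp].
rewrite type_partE; apply: big1 => S _; apply: ext_d_eq0 => // y Uy w.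
rewrite type_part_holo //; [|exact: fm | exact: fp].
by rewrite ltn_eqF.
Qed.

End TypeParts.

(** * The three conditions in terms of the trace of the nonmetricity *)

Section Equivalences.
Variables (R : realType) (m n : nat) (m4 : m = (4 * n)%N) (M : manifold R m).
Variables (H : hypercomplex M) (g : quaternionic_hermitian H) (a : chart_index M).
Local Notation to_C := (map_mx (real_complex R)).
Local Notation U := (dom a).
Local Notation I := (cI H a).
Local Notation J := (cJ H a).
Local Notation gm := (metric g a).
Local Notation P10 y := (p10 'i (to_C (I y))).
Local Notation P01 y := (p01 'i (to_C (I y))).
Local Notation Th y := (Theta 'i (to_C (I y)) (to_C (J y)) (to_C (gm y))).

Lemma Omega_pow y k : U y -> wedge_pow (Omega g) k a y = @wedge_expn _ m (Th y) k.
Proof.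
move=> Uy; apply/funext => w; rewrite (wedge_pow_wedge_expn _ _ (@Omega_bilin _ _ _ _ g
  a)).
by rewrite ThetaCE.
Qed.

Lemma Omega_pow_multilinear y k : U y -> multilinear (wedge_pow (Omega g) k a y).
Proof. by move=> Uy; rewrite Omega_pow //; exact: wedge_expn_multilinear. Qed.

Lemma Omega_pow_p10 y k : U y -> forall w,
  wedge_pow (Omega g) k a y (P10 y *m w) = wedge_pow (Omega g) k a y w.
Proof.
move=> Uy w; rewrite Omega_pow //; apply: Om_p10.
- exact: sqri.
- exact: Ic_sq.
- exact: IJc.
- exact: gIc.
Qed.

Variables (x : 'cV[R]_m) (Ux : U x) (G : 'I_m -> 'M[R]_m).
Hypothesis Gsym : forall k l, col k (G l) = col l (G k).
Hypothesis GI : forall l, partial_mx I x l = I x *m G l - G l *m I x.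
Hypothesis GJ : forall l, partial_mx J x l = J x *m G l - G l *m J x.

Local Notation E l := (to_C (nonmetricity g a x G l)).

Lemma ext_d_Omega_pow k v : ext_d (wedge_pow (Omega g) k) a x v =
  2^-1 * ext_diff (fun l => gl_act (E l) (@wedge_expn _ m (Th x) k)) v.
Proof.
rewrite -(ThetaCE g Ux).
apply: (ext_d_frame Gsym (wedge_expn_multilinear (k := k) _) (wedge_expn_alt (k := k)
  _)).
apply: (wedge_pow_cder (@Omega_bilin _ _ _ _ g a)) => l.
exact (@ThetaC_cder R m M H g a x Ux G GI GJ l).
Qed.

Lemma ext_d_omegaI_pow k v : ext_d (wedge_pow (omegaI g) k) a x v =
  2^-1 * ext_diff (fun l => gl_act (E l) (@wedge_expn _ m (omC g a x) k)) v.
Proof.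
apply: (ext_d_frame Gsym (wedge_expn_multilinear (k := k) _) (wedge_expn_alt (k := k)
  _)).
apply: (wedge_pow_cder (@omegaI_bilin _ _ _ _ g a)) => l.
exact (@omC_cder R m M H g a x Ux G GI l).
Qed.

(** The condition of [delbar_trace] is on the (0,1)-part of a real 1-form. *)
Lemma delbar_iff :
  (forall v, delbar (cI H) (wedge_pow (Omega g) n) a x v = 0) <->
  trace_row g a x G = 0.
Proof.
have I2 := Ic_sq H Ux; have IJ := IJc H Ux; have gI := gIc g Ux.
have dE v : delbar (cI H) (wedge_pow (Omega g) n) a x v =
    2^-1 * \sum_(S : {set 'I_(n * 2).+1} | #|S| == (n * 2)%N)
       ext_diff (fun l => gl_act (E l) (@wedge_expn _ m (Th x) n)) (type_mix 'i (to_C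
         (I x)) S v).
  rewrite delbarE //; first last.
  - by move=> y Uy; exact: Omega_pow_p10.
  - by move=> y Uy; exact: Omega_pow_multilinear.
  - by move=> y Uy; exact: I_sq.
  rewrite mulr_sumr; apply: eq_bigr => S _; exact: ext_d_Omega_pow.
apply: (iff_trans (B := to_C (trace_row g a x G) *m P01 x = 0)); last first.
  by split=> [/real_row_p01 //|->]; rewrite map_mx0 mul0mx.
rewrite -tr_rowC -(delbar_trace (sqri R) I2 (Jc_sq H Ux) IJ (gc_sym g Ux) (gc_unit g Ux)
  gI (gJc g Ux) (EIC g Ux GI) (EJC g Ux GJ) m4).
split=> h v; have := h v; rewrite dE.
  by move/eqP; rewrite mulf_eq0 invr_eq0 pnatr_eq0 /= => /eqP.
by move=> ->; rewrite mulr0.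
Qed.

Lemma parallel_iff (D : connection M) : (forall l, conn D a l x = G l) ->
  (forall u v, cov_deriv_form D (wedge_pow (Omega g) n) a x u v = 0) <->
  trace_row g a x G = 0.
Proof.
move=> DG; have I2 := Ic_sq H Ux; have IJ := IJc H Ux; have gI := gIc g Ux.
pose Om := @wedge_expn _ m (Th x) n.
have Omm : multilinear Om := wedge_expn_multilinear (k := n) _.
have cE u v : cov_deriv_form D (wedge_pow (Omega g) n) a x u v =
    4^-1 * (to_C (trace_row g a x G) *m u) 0 0 * Om v.
  have -> : cov_deriv_form D (wedge_pow (Omega g) n) a x u v =
      \sum_l u l 0 * gl_act (to_C (frame_gen g a x G l)) Om v
      - gl_act (\sum_l u l 0 *: to_C (G l)) Om v.
    rewrite /cov_deriv_form; congr (_ - _).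
      apply: eq_bigr => l _; congr (_ * _); apply: cder_cpartial.
      rewrite /Om -(ThetaCE g Ux).
      apply: (wedge_pow_cder (@Omega_bilin _ _ _ _ g a)) => l'.
      exact (@ThetaC_cder R m M H g a x Ux G GI GJ l').
    apply: eq_bigr => i _; rewrite Omega_pow // /Om; congr (wedge_expn _ _).
    apply/matrixP=> p q; rewrite !mxE; case: eqP => // ->.
    apply: eq_bigr => r _; rewrite [in RHS]mxE; congr (_ * _).
    by rewrite !summxE; apply: eq_bigr => l _; rewrite DG.
  rewrite gl_act_suml // -sumrB mxE mulr_sumr mulr_suml; apply: eq_bigr => l _.
  have frame_genE : to_C (frame_gen g a x G l) = to_C (G l) + 2^-1 *: E l.
    by rewrite /frame_gen map_mxD map_mxZ /= fmorphV rmorph_nat.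
  rewrite frame_genE gl_actDl // !gl_actZl // -mulrBr addrC addKr.
  rewrite (gl_act_Om (sqri R) I2 (Jc_sq H Ux) IJ gI m4 _ (EIC g Ux GI l) (EJC g Ux GJ
    l)).
  rewrite trace_map_mx !mxE -/Om.
  have -> : 4^-1 = 2^-1 * 2^-1 :> R[i] by rewrite -invfM -natrM.
  ring.
split=> [h|t0 u v]; last by rewrite cE t0 map_mx0 mul0mx mxE mulr0 mul0r.
have [B [_ OmB]] := Om_basis (sqri R) I2 (Jc_sq H Ux) IJ (gc_sym g Ux) (gc_unit g Ux)
  gI (gJc g Ux) m4.
apply/rowP=> l; rewrite [RHS]mxE.
have := h (delta_mx l 0) B; rewrite cE -colE => /eqP.
rewrite !mulf_eq0 (negPf OmB) orbF invr_eq0 pnatr_eq0 /= mxE mxE.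
by move=> /eqP/(congr1 (@complex.Re R)).
Qed.

(** The (1,0)-parts of two real 1-forms determine them. *)
Lemma hkt_rows : (forall v, del (cI H) (Omega g) a x v = 0) ->
  trace_row g a x G = 4 *: divergence_row g a x G.
Proof.
move=> hkt; have I2 := Ic_sq H Ux; have IJ := IJc H Ux; have gI := gIc g Ux.
have Omb y : U y -> Omega g a y = bilin (Th y).
  by move=> Uy; apply/funext => w; rewrite Omega_bilin ThetaCE.
have dO v : ext_d (Omega g) a x v = 2^-1 * ext_diff (fun l => gl_act (E l) (bilin (Th
  x))) v.
  rewrite -(ThetaCE g Ux).
  apply: (ext_d_frame Gsym (bilin_multilinear _)).
    rewrite (ThetaCE g Ux); apply: bilin_alt.
    exact: Theta_antisym IJ (gc_sym g Ux) gI (gJc g Ux).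
  move=> l w; rewrite gl_act_bilin; under eq_fun do rewrite Omega_bilin.
  by apply: cder_bilin; exact (@ThetaC_cder R m M H g a x Ux G GI GJ l).
have := hkt_trace (sqri R) I2 (Jc_sq H Ux) IJ (gc_sym g Ux) (gc_unit g Ux)
  gI (gJc g Ux) (EgC g Ux G) (EIC g Ux GI) (EJC g Ux GJ).
rewrite tr_rowC div_rowC => rows.
have {}rows : to_C (trace_row g a x G - 4 *: divergence_row g a x G) *m P10 x = 0.
  rewrite map_mxB map_mxZ /= rmorph_nat mulmxBl rows ?scalemxAl ?subrr // => v.
  have := hkt v; rewrite delE //; first last.
  - move=> y Uy w; rewrite Omb //.
    have Tc := Theta_congr (sqri R) (Ic_sq H Uy) (IJc H Uy) (gIc g Uy).
    by rewrite [LHS]bilin_mulmx Tc.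
  - by move=> y Uy; rewrite Omb //; exact: bilin_multilinear.
  - by move=> y Uy; exact: I_sq.
  by rewrite dO => /eqP; rewrite mulf_eq0 invr_eq0 pnatr_eq0 /= => /eqP.
by apply/eqP; rewrite -subr_eq0; apply/eqP; exact: real_row_p10 rows.
Qed.

(** On the one hand tr E = 4 div E, on the other tr E = 2 div E. *)
Lemma balanced_iff : (0 < n)%N -> (forall v, del (cI H) (Omega g) a x v = 0) ->
  (forall v, ext_d (wedge_pow (omegaI g) (2 * n).-1) a x v = 0) <->
  trace_row g a x G = 0.
Proof.
move=> n0 /hkt_rows rows.
have mk : m = (2 + (2 * n).-1 * 2)%N.
  by rewrite m4; case: n n0 => // p _; rewrite mulnS /= -[in RHS]mulSn -mulnS; lia.
have Wa : (omC g a x)^T = - omC g a x.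
  by rewrite /omC map_trmx trmx_mul (metric_sym g Ux) (metric_I g Ux) map_mxN.
have Iu : I x \in unitmx.
  by have [] := @mulmx1_unit _ _ (I x) (- I x); rewrite ?mulmxN ?I_sq ?opprK.
have Wu : omC g a x \in unitmx.
  by rewrite /omC map_unitmx unitmx_mul (metric_unit g Ux).
have EW l : (E l)^T *m omC g a x = omC g a x *m E l.
  rewrite /omC map_trmx -!map_mxM; congr map_mx.
  by rewrite mulmxA (nonmetricity_g g Ux G l) -(mulmxA (gm x) (nonmetricity g a x G l))
    (nonmetricity_I g Ux GI) mulmxA.
have bal := ext_diff_wedge_expn_trace mk Wa Wu EW.
have dE l : \tr (E l) = (trace_row g a x G 0 l)%:C by rewrite trace_map_mx mxE.
have divE l : \sum_j E j j l = (divergence_row g a x G 0 l)%:C.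
  by rewrite mxE rmorph_sum; apply: eq_bigr => j _; rewrite mxE.
have row4 l : trace_row g a x G 0 l = 4 * divergence_row g a x G 0 l by rewrite rows
  mxE.
split=> [h|t0 v].
  have /bal tr2 : forall v, ext_diff (fun l => gl_act (E l) (@wedge_expn _ m (omC g a
    x) (2 * n).-1)) v = 0.
    move=> v; have := h v; rewrite ext_d_omegaI_pow => /eqP.
    by rewrite mulf_eq0 invr_eq0 pnatr_eq0 /= => /eqP.
  apply/rowP=> l; rewrite [RHS]mxE.
  have := tr2 l; rewrite dE divE -[2](rmorph_nat (real_complex R)) -rmorphM.
  move=> /(congr1 (@complex.Re R)) /= r2; have r4 := row4 l.
  lra.
have trE l : \tr (E l) = 2 * \sum_j E j j l.
  have r4 := row4 l; rewrite t0 mxE in r4.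
  rewrite dE divE t0 mxE (_ : divergence_row g a x G 0 l = 0) ?mulr0 //.
  lra.
by rewrite ext_d_omegaI_pow (bal.2 trE) mulr0.
Qed.

End Equivalences.

Theorem theorem4p8 (R : realType) (n : nat) (n_gt0 : (0 < n)%N)
    (M : manifold R (4 * n)) (H : hypercomplex M)
    (g : quaternionic_hermitian H) (g_HKT : HKT g) :
  (form_eq0 (delbar (cI H) (wedge_pow (Omega g) n))
     <-> balanced (2 * n) (omegaI g)) /\
  (forall nabla : connection M, is_obata H nabla ->
     (form_eq0 (delbar (cI H) (wedge_pow (Omega g) n))
        <-> parallel nabla (wedge_pow (Omega g) n))).
Proof.
split.
  have at_pt a x (Ux : dom a x) : (forall v, delbar (cI H) (wedge_pow (Omega g) n) a x
    v = 0) <->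
      (forall v, ext_d (wedge_pow (omegaI g) (2 * n).-1) a x v = 0).
    have [G [Gsym GI GJ]] := obata_at H Ux.
    have hkt v : del (cI H) (Omega g) a x v = 0 by exact: g_HKT.
    apply: (iff_trans (delbar_iff erefl g Ux Gsym GI GJ)).
    exact: iff_sym (balanced_iff erefl Ux Gsym GI GJ n_gt0 hkt).
  by split=> h a x Ux; apply/(at_pt a x Ux) => v; exact: h.
move=> nabla [tf pI pJ pK].
have sm_cst (a : chart_index M) (v : 'cV[R]_(4 * n)) : smooth_mx_on (dom a) (fun=> v).
  exact: smooth_mx_on_cst.
have conn_col a (v x : 'cV[R]_(4 * n)) l : dom a x ->
    cov_deriv nabla a (fun=> basis_vec l) (fun=> v) x = conn nabla a l x *m v.
  move=> Ux; rewrite /cov_deriv (derive_cst v) add0r; congr (_ *m _).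
  by rewrite -/(lincomb_mx (fun j => conn nabla a j x) (basis_vec l)) lincomb_mx_delta.
have at_pt a x (Ux : dom a x) :
    (forall v, delbar (cI H) (wedge_pow (Omega g) n) a x v = 0) <->
    (forall u v, cov_deriv_form nabla (wedge_pow (Omega g) n) a x u v = 0).
  pose G l := conn nabla a l x.
  have Gsym k l : col k (G l) = col l (G k).
    have := tf a (fun=> basis_vec l) (fun=> basis_vec k)
      (sm_cst _ _) (sm_cst _ _) x Ux.
    rewrite !conn_col // /lie_bracket !derive_cst subrr => /eqP.
    by rewrite subr_eq0 -!colE => /eqP.
  have pres (A : components M) : (forall a, smooth_mx_on (dom a) (A a)) -> preserves
    nabla A ->
      forall l, partial_mx (A a) x l = A a x *m G l - G l *m A a x.
    move=> As pA l; apply: mulmx_ext => v.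
    have := pA a (fun=> basis_vec l) (fun=> v) (sm_cst _ _) (sm_cst _ _) x Ux.
    rewrite [in RHS]/appf conn_col // => E.
    rewrite mulmxBl -!mulmxA -E /cov_deriv.
    have -> : 'D_(basis_vec l) (appf (A a) (fun=> v)) x = partial_mx (A a) x l *m v.
      apply: mxder_derive; rewrite -[X in mxder _ _ _ X]addr0 -(mulmx0 _ (A a x)).
      by apply: mxder_mul; [exact: (smooth_mxder l (As a) Ux) | exact: mxder_cst].
    rewrite -/(lincomb_mx (fun j => conn nabla a j x) (basis_vec l)) lincomb_mx_delta.
    by rewrite /appf addrK.
  have GI := pres _ (@smooth_I _ _ _ H) pI; have GJ := pres _ (@smooth_J _ _ _ H) pJ.
  apply: (iff_trans (delbar_iff erefl g Ux Gsym GI GJ)).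
  exact: iff_sym (parallel_iff erefl g Ux GI GJ (fun l => erefl)).
split=> h a x Ux; first exact: (at_pt a x Ux).1 (h a x Ux).
exact: (at_pt a x Ux).2 (h a x Ux).
Qed.
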